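(* Let $\Lambda=(\lambda_n)_{n\ge1}$ be an increasing sequence of positive real numbers with $\sum_{n\ge1}\frac1{\lambda_n}<\infty$. If $\Lambda$ is quasilacunary, then every sublinear measure $\mu$ on $[0,1]$ is $\Lambda$-embedding.
   Context: Measures $\mu$ are finite positive Borel measures on $[0,1]$ with $\mu(\{1\})=0$. $m$ is Lebesgue measure on $[0,1]$ and $\|\cdot\|_1$ is the norm of $L^1(m)$. ''Increasing'' for $\Lambda$ means strictly increasing. $M_\Lambda^1$ denotes the closed linear span in $L^1(m)$ of the functions $x^{\lambda_n}$, $n\ge1$; ''polynomials in $M^1_\Lambda$'' are the finite linear combinations of the $x^{\lambda_n}$. $\mu$ is $\Lambda$-embedding if there is a constant $C>0$ such that $\|p\|_{L^1(\mu)}\le C\|p\|_1$ for all polynomials $p$ in $M_\Lambda^1$. For $0<\epsilon<1$ let $J_\epsilon=[1-\epsilon,1]$. $\mu$ is sublinear if there is a constant $C>0$ such that $\mu(J_\epsilon)\le C\epsilon$ for all $0<\epsilon<1$. $\Lambda$ is quasilacunary if for some increasing sequence $(n_k)$ of (positive) integers and some $q>1$ we have $\lambda_{n_{k+1}}/\lambda_{n_k}\ge q$ for all $k$, and $\sup_k(n_{k+1}-n_k)<\infty$. *)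

(* Defs.v *)
From HB Require Import structures.
From mathcomp Require Import all_boot all_order all_algebra.
From mathcomp Require Import all_classical all_reals all_analysis.
From mathcomp Require Import complex.

Set Implicit Arguments.
Unset Strict Implicit.
Unset Printing Implicit Defensive.

Import Order.TTheory GRing.Theory Num.Theory.

Local Open Scope classical_set_scope.
Local Open Scope ring_scope.
Local Open Scope complex_scope.

(* Sequences are indexed from 0: [lam n] stands for lambda_(n+1). *)

(* The finite linear combination \sum_(i < N) c_i x^(lam i), with complex
   coefficients; real ones are the special case of zero imaginary parts. *)
Definition muntz_poly (R : realType) (lam : nat -> R) (N : nat)
    (c : 'I_N -> R[i]) (x : R) : R[i] :=
  \sum_(i < N) c i * (x `^ lam i)%:C.

(* The L^1(mu)-norm over [0,1] of a complex-valued function. *)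
Definition L1norm01 (R : realType)
    (mu : {measure set (measurableTypeR R) -> \bar R})
    (f : R -> R[i]) : \bar R :=
  (\int[mu]_(x in `[0%R, 1%R]) (Normc.normc (f x))%:E)%E.

(* A measure on [0,1] without mass at 1 is encoded as a Borel measure on R
   that vanishes outside [0,1] and on {1}. *)
Definition on_unit_interval (R : realType)
    (mu : {measure set (measurableTypeR R) -> \bar R}) : Prop :=
  mu (~` `[0, 1]) = 0%E /\ mu [set 1] = 0%E.

Definition embedding (R : realType) (lam : nat -> R)
    (mu : {measure set (measurableTypeR R) -> \bar R}) : Prop :=
  exists2 C : R, 0 < C &
    forall (N : nat) (c : 'I_N -> R[i]),
      (L1norm01 mu (muntz_poly lam c)
        <= C%:E * L1norm01 lebesgue_measure (muntz_poly lam c))%E.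

Definition sublinear (R : realType)
    (mu : {measure set (measurableTypeR R) -> \bar R}) : Prop :=
  exists2 C : R, 0 < C &
    forall eps : R, 0 < eps < 1 -> (mu `[(1 - eps)%R, 1%R]%classic <= (C * eps)%:E)%E.

Definition quasilacunary (R : realType) (lam : nat -> R) : Prop :=
  exists (n : nat -> nat) (q : R),
    [/\ {homo n : k l / (k < l)%N},
        1 < q,
        forall k, q <= lam (n k.+1) / lam (n k)
      & exists B : nat, forall k, (n k.+1 - n k <= B)%N].

(* Main.v *)
(* Put x = exp (- t), so that a polynomial becomes an exponential sum f(t).
   Quasilacunarity lets one cut Lambda into consecutive blocks of bounded size
   and bounded ratio, separated by a fixed ratio q > 1.  Write f = sum_k f_k
   accordingly, let a_k be the smallest exponent of block k and let U_k be the
   supremum of |f_k| on t >= 0.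

   A discrete convolution with the translates of f isolates f_k: it reproduces
   block k exactly, annihilates exactly all higher blocks and the K blocks just
   below, and contains an r-th difference of step 1/a_k, which is small on the
   remaining lower blocks by a Bernstein inequality.  Averaging over a dilation
   of the translates turns this into
     U_k <= C a_k w_k + C sum_(j < k - K) (C a_j / a_k)^r U_j,
   where w_k is the integral of |p| over a window -ln x ~ 1/a_k.  The windows
   have bounded overlap, and for r and then K large the second sum is absorbed,
   so sum_k U_k / a_k <= C ||p||_1.  Since f_k decays exponentially at scale
   1/a_k, a sublinear mu gives |f_k| the integral O(U_k / a_k). *)
Require Import Defs.
From mathcomp Require Import all_boot all_order all_algebra.
From mathcomp Require Import all_classical all_reals all_analysis.
From mathcomp Require Import measurable_realfun ring lra zify.
Set Implicit Arguments.
Unset Strict Implicit.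
Unset Printing Implicit Defensive.
Import Order.TTheory GRing.Theory Num.Theory.
Local Open Scope classical_set_scope.
Local Open Scope ring_scope.

(** * Exponential sums and their multipliers *)

Section Laplace.
Variable R : realType.
Implicit Types (l h : seq (R * R)) (m : R -> R) (a b t N S U : R).

(** The delicate point is the absorption. Annihilating the K blocks just below block k costs a
    factor [N2] per block in the norm of the convolution, while the r-th difference gains q^(-r) per
    block on everything lower. [N2] is found before r, so r can be taken with q^r >= 2 [N2]; only
    then is K taken, to beat the constants that depend on r. Exponents inside a block may be
    arbitrarily close, so Lagrange interpolation on a block has no uniform bound. The estimates on a
    block therefore depend only on the number of its exponents and on bounds for their size, and
    come from removing exponents one at a time by a difference operator or a factor. Every
    translation in the convolution is by at least 1/a_k. This keeps the windows away from x = 1,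
    without which their overlap would not be bounded. *)

Definition expsum h t : R := \sum_(p <- h) p.1 * expR (- (p.2 * t)).

(* m is the Laplace transform of a finite atomic measure on [0, S] of total
   variation at most N; it acts on exponential sums by multiplying the
   coefficient of exp(- g t) by m g, i.e. by a combination of translations. *)
Definition laplace N S m := exists l,
  [/\ forall p, p \in l -> 0 <= p.2 <= S, \sum_(p <- l) `|p.1| <= N
    & forall x, m x = expsum l x].

Definition act m h : seq (R * R) := [seq (p.1 * m p.2, p.2) | p <- h].

Lemma expsum_cat h1 h2 t : expsum (h1 ++ h2) t = expsum h1 t + expsum h2 t.
Proof. by rewrite /expsum big_cat. Qed.

Lemma expsum_act m h t :
  expsum (act m h) t = \sum_(p <- h) p.1 * m p.2 * expR (- (p.2 * t)).
Proof. by rewrite /expsum /act big_map. Qed.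

Lemma laplace_ge0 N S m : laplace N S m -> 0 <= N.
Proof. by case=> l [_ + _]; apply: le_trans; apply: sumr_ge0. Qed.

Lemma laplace_eq N S m m' : (forall x, m x = m' x) ->
  laplace N S m -> laplace N S m'.
Proof. by move=> e [l [? ? H]]; exists l; split => // x; rewrite -e. Qed.

Lemma laplace_le N' S' N S m : N <= N' -> S <= S' ->
  laplace N S m -> laplace N' S' m.
Proof.
move=> NN SS [l [H1 H2 H3]]; exists l; split => //; last exact: le_trans NN.
by move=> p /H1 /andP[-> /le_trans]; apply.
Qed.

Lemma laplace0 S : laplace 0 S (fun=> 0).
Proof. by exists [::]; split; rewrite ?big_nil// => x; rewrite /expsum big_nil. Qed.

Lemma laplace_cst c : laplace `|c| 0 (fun=> c).
Proof.
exists [:: (c, 0)]; split=> [p||x]; rewrite ?big_seq1//.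
  by rewrite inE => /eqP ->; rewrite /= lexx.
by rewrite /expsum big_seq1/= mul0r oppr0 expR0 mulr1.
Qed.

Lemma laplace_shift s : 0 <= s -> laplace 1 s (fun x => expR (- (s * x))).
Proof.
move=> s0; exists [:: (1, s)]; split=> [p||x]; rewrite ?big_seq1/= ?normr1//.
  by rewrite inE => /eqP ->; rewrite /= lexx s0.
by rewrite /expsum big_seq1/= mul1r.
Qed.

Lemma laplaceD N1 N2 S m1 m2 : laplace N1 S m1 -> laplace N2 S m2 ->
  laplace (N1 + N2) S (fun x => m1 x + m2 x).
Proof.
move=> [l1 [A1 B1 C1]] [l2 [A2 B2 C2]]; exists (l1 ++ l2); split=> [p||x].
- by rewrite mem_cat => /orP[/A1|/A2].
- by rewrite big_cat lerD.
- by rewrite expsum_cat C1 C2.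
Qed.

Lemma laplaceM N1 N2 S1 S2 m1 m2 : laplace N1 S1 m1 -> laplace N2 S2 m2 ->
  laplace (N1 * N2) (S1 + S2) (fun x => m1 x * m2 x).
Proof.
move=> [l1 [A1 B1 C1]] [l2 [A2 B2 C2]].
exists [seq (p.1 * q.1, p.2 + q.2) | p <- l1, q <- l2]; split=> [p||x].
- move=> /allpairsP[[u v]/= [/A1 /andP[? ?] /A2 /andP[? ?] ->]]/=.
  by rewrite addr_ge0// lerD.
- rewrite big_allpairs_dep/=.
  under eq_bigr do under eq_bigr do rewrite normrM.
  under eq_bigr do rewrite -mulr_sumr.
  by rewrite -mulr_suml ler_pM// sumr_ge0.
- rewrite C1 C2 /expsum big_allpairs_dep/= mulr_suml; apply: eq_bigr => p _.
  rewrite mulr_sumr; apply: eq_bigr => r _.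
  by rewrite mulrDl opprD expRD mulrACA.
Qed.

Lemma laplaceZ c N S m : laplace N S m ->
  laplace (`|c| * N) S (fun x => c * m x).
Proof. by move=> /(laplaceM (laplace_cst c)); rewrite add0r. Qed.

Lemma laplace_prod (I : eqType) (r : seq I) (N S : I -> R) (m : I -> R -> R) :
  (forall i, i \in r -> laplace (N i) (S i) (m i)) ->
  laplace (\prod_(i <- r) N i) (\sum_(i <- r) S i)
    (fun x => \prod_(i <- r) m i x).
Proof.
elim: r => [_|i r IH H].
  rewrite !big_nil; have := laplace_cst 1; rewrite normr1.
  by apply: laplace_eq => x; rewrite big_nil.
rewrite !big_cons; apply: laplace_eq (laplaceM (H i (mem_head _ _)) (IH _)).
  by move=> x; rewrite big_cons.
by move=> j jr; apply: H; rewrite inE jr orbT.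
Qed.

Lemma laplaceX N S m n : laplace N S m ->
  laplace (N ^+ n) (S *+ n) (fun x => m x ^+ n).
Proof.
move=> H; have := @laplace_prod _ (iota 0 n) (fun=> N) (fun=> S) (fun=> m) (fun _ _ => H).
rewrite !big_const_seq count_predT size_iota iter_mulr_1 iter_addr_0.
by apply: laplace_eq => x; rewrite big_const_seq count_predT size_iota iter_mulr_1.
Qed.

Lemma expsum_act_laplace l h t :
  expsum (act (expsum l) h) t = \sum_(q <- l) q.1 * expsum h (t + q.2).
Proof.
rewrite expsum_act /expsum.
under [RHS]eq_bigr do rewrite mulr_sumr.
rewrite [RHS]exchange_big/=; apply: eq_bigr => p _.
rewrite mulr_sumr mulr_suml; apply: eq_bigr => q _.
by rewrite mulrDr opprD expRD [q.2 * _]mulrC; ring.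
Qed.

Lemma act_eq m m' h t : {in h, forall p, m p.2 = m' p.2} ->
  expsum (act m h) t = expsum (act m' h) t.
Proof.
move=> e; rewrite !expsum_act big_seq [RHS]big_seq.
by apply: eq_bigr => p /e ->.
Qed.

Lemma act1 h t m : {in h, forall p, m p.2 = 1} ->
  expsum (act m h) t = expsum h t.
Proof.
move=> e; rewrite (@act_eq _ (fun=> 1))// expsum_act.
by apply: eq_bigr => p _; rewrite mulr1.
Qed.

Lemma act0 h t m : {in h, forall p, m p.2 = 0} -> expsum (act m h) t = 0.
Proof.
move=> e; rewrite expsum_act big_seq big1// => p /e ->.
by rewrite mulr0 mul0r.
Qed.

Lemma act_bound N S m h t U : laplace N S m -> 0 <= U ->
  (forall u, t <= u <= t + S -> `|expsum h u| <= U) ->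
  `|expsum (act m h) t| <= N * U.
Proof.
move=> [l [A B C]] U0 H.
rewrite (@act_eq _ (expsum l)); last by move=> p _; exact: C.
rewrite expsum_act_laplace (le_trans (ler_norm_sum _ _ _))//.
apply: (@le_trans _ _ (\sum_(p <- l) `|p.1| * U)); last first.
  by rewrite -mulr_suml ler_wpM2r.
rewrite big_seq [leRHS]big_seq; apply: ler_sum => p /A /andP[p0 pS].
by rewrite normrM ler_wpM2l// H// lerDl p0 lerD2l.
Qed.

Lemma expsum_shift h t s :
  expsum h (t + s) = expsum (act (fun x => expR (- (s * x))) h) t.
Proof.
rewrite expsum_act; apply: eq_bigr => p _.
by rewrite -mulrA -expRD mulrDr opprD addrC [s * _]mulrC.
Qed.

Lemma expRN_le a : 0 < a -> expR (- a) <= a^-1.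
Proof.
move=> a0; rewrite expRN lef_pV2 ?posrE ?expR_gt0//.
by apply: le_trans (expR_ge1Dx a); rewrite lerDr.
Qed.

(* Expand prod_g (T_s - e^(-s g)), with T_s the translation by s. *)
Lemma expsum_recurrence a s (gs : seq R) : 0 <= s ->
  {in gs, forall g, a <= g} ->
  exists2 m, laplace ((1 + expR (- (a * s))) ^+ size gs - 1)
               (s * (size gs)%:R - s) m
    & {in gs, forall g, expR (- (s * (size gs)%:R * g)) = m g}.
Proof.
move=> s0 ags.
suff [m H1 H2] : exists2 m, laplace ((1 + expR (- (a * s))) ^+ size gs - 1)
               (s * (size gs)%:R - s) m
    & forall x, expR (- (s * (size gs)%:R * x)) - m x =
        \prod_(g <- gs) (expR (- (s * x)) - expR (- (s * g))).
  exists m => // g ggs; apply/eqP; rewrite -subr_eq0 H2.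
  by rewrite (big_rem g)//= subrr mul0r.
elim: gs ags => [|g gs IH] ags.
  exists (fun=> 0); first by rewrite expr0 subrr; exact: laplace0.
  by move=> x; rewrite big_nil /= mulr0 mul0r oppr0 expR0 addr0.
have [|m H1 H2] := IH; first by move=> x xg; apply: ags; rewrite inE xg orbT.
set n := size gs in H1 H2 *.
set z := expR (- (s * g)).
have zle : z <= expR (- (a * s)).
  by rewrite ler_expR lerN2 mulrC ler_wpM2l// ags// mem_head.
(* With n the size of [gs], the new product is (e^(-sx) - z)(e^(-snx) - m x), and this is
   e^(-s(n+1)x) minus it. With w = e^(-as) >= z and W = (1 + w)^n, the norm is at most z + (1 + z)(W
   - 1) <= (1 + w)W - 1. *)
exists (fun x => z * expR (- (s * n%:R * x)) + (expR (- (s * x)) * m x + - z * m x)).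
  have sn : 0 <= s * n%:R by rewrite mulr_ge0.
  apply: (@laplace_le _ _ (z * 1 + (1 * ((1 + expR (- (a * s))) ^+ n - 1) +
      z * ((1 + expR (- (a * s))) ^+ n - 1))) (s * n%:R)).
  - rewrite /= -/n exprS; have := laplace_ge0 H1.
    move: (expR (- (a * s))) zle => w zle; set W := _ ^+ _ => W1.
    have := ler_wpM2r W1 zle; rewrite /W; move: z zle (_ ^+ _) => z zle V. by lra.
  - by rewrite /= -/n -natr1; lra.
  apply: laplaceD.
    by have := laplaceZ z (laplace_shift sn); rewrite ger0_norm ?expR_ge0.
  apply: laplaceD.
    by rewrite -[X in laplace _ X _](subrKC s); apply: laplaceM => //; exact: laplace_shift.
  have : laplace ((1 + expR (- (a * s))) ^+ n - 1) (s * n%:R) m.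
    by apply: laplace_le H1 => //; lra.
  by move=> /(laplaceZ (- z)); rewrite normrN ger0_norm ?expR_ge0.
move=> x; rewrite big_cons -H2 /= -/n -natr1.
by rewrite mulrDr mulr1 mulrDl opprD expRD /z; ring.
Qed.

Lemma exprD1_le (x : R) n : 0 <= x -> x *+ n <= 2^-1 ->
  (1 + x) ^+ n - 1 <= x *+ n *+ 2.
Proof.
move=> x0; elim: n => [|n IH]; first by rewrite expr0 subrr !mulr0n mul0rn.
rewrite exprS => H.
have H' : x *+ n <= 2^-1 by apply: le_trans H; rewrite mulrSr lerDl.
have := IH H'; move: H H'; rewrite mulrSr; set w := _ ^+ _; set y := x *+ n => H H' K.
have y0 : 0 <= y by rewrite mulrn_wge0.
have : x * (w - 1) <= x * 1 by apply: ler_wpM2l => //; lra.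
by lra.
Qed.

(* For a step s >> 1/a the recurrence above has coefficients of total size
   at most 1/2, whence the geometric decay. *)
Lemma expsum_decay (D : nat) h a U : (0 < D)%N -> 0 < a -> (size h <= D)%N ->
  {in h, forall p, a <= p.2} ->
  (forall t, 0 <= t <= (4 * D ^ 2)%:R / a -> `|expsum h t| <= U) ->
  forall j t, ((4 * D ^ 2)%:R / a) *+ j <= t -> `|expsum h t| <= U / 2 ^+ j.
Proof.
move=> D0 a0 hD ha HU.
(* Then e^(-as) = e^(-4D) <= 1/(4D), so (1 + e^(-as))^D - 1 <= 1/2, and D steps cover the length 4
   D^2 / a. *)
set s := (4 * D)%:R / a.
have s0 : 0 < s by rewrite divr_gt0// ltr0n muln_gt0.
have tauE : (4 * D ^ 2)%:R / a = s * D%:R.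
  by rewrite /s !natrM ?natrX; field; rewrite gt_eqF.
rewrite tauE in HU *.
have sD0 : 0 < s * D%:R by rewrite mulr_gt0// ltr0n.
have U0 : 0 <= U by apply: le_trans (HU 0 _) => //; rewrite lexx ltW.
have ags : {in map snd h, forall g, a <= g}.
  by move=> g /mapP[p ph ->]; exact: ha.
have [m Hm1 Hm2] := expsum_recurrence (ltW s0) ags.
rewrite size_map in Hm1 Hm2; set n := size h in hD Hm1 Hm2.
have nD : s * n%:R <= s * D%:R by rewrite ler_pM2l// ler_nat.
have {}Hm1 : laplace 2^-1 (s * n%:R - s) m.
  apply: laplace_le Hm1 => //.
  have DR : 0 < D%:R :> R by rewrite ltr0n.
  have zs : expR (- (a * s)) <= ((4 * D)%:R)^-1.
    rewrite (_ : a * s = (4 * D)%:R); last by rewrite /s; field; rewrite gt_eqF.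
    by apply: expRN_le; rewrite ltr0n muln_gt0.
  have zn : expR (- (a * s)) *+ n <= 4^-1.
    apply: (@le_trans _ _ ((4 * D)%:R ^-1 *+ D)).
      apply: (@le_trans _ _ ((4 * D)%:R ^-1 *+ n)); first by rewrite lerMn2r zs orbT.
      by rewrite ler_wpMn2l// invr_ge0.
    by rewrite -[_ *+ D]mulr_natr natrM invfM -mulrA mulVf ?mulr1// gt_eqF.
  apply: le_trans (exprD1_le _ _) _; rewrite ?expR_ge0//; first by lra.
  by lra.
have halve t V : s * n%:R <= t -> 0 <= V ->
    (forall u, t - s * n%:R <= u <= t - s -> `|expsum h u| <= V) ->
    `|expsum h t| <= V / 2.
  move=> st V0 HV; rewrite -[t in expsum h t](subrK (s * n%:R)) expsum_shift.
  rewrite (@act_eq _ m); last by move=> p ph; apply: Hm2; apply/mapP; exists p.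
  rewrite [V / 2]mulrC; apply: act_bound Hm1 V0 _ => u /andP[u1 u2].
  by apply: HV; rewrite u1/=; lra.
(* The values used by [halve] lie no further than t - s, so the bound extends by a length s at each
   induction step. *)
have bnd k : forall u, 0 <= u <= s * D%:R + s *+ k -> `|expsum h u| <= U.
  elim: k => [|k IH] u; first by rewrite addr0; exact: HU.
  rewrite mulrSr => /andP[u0 u1].
  have [uk|uk] := leP u (s * D%:R + s *+ k); first by apply: IH; rewrite u0.
  have sk : 0 <= s *+ k by rewrite mulrn_wge0// ltW.
  apply: le_trans (halve u U _ U0 _) _; [by lra| |by lra].
  move=> v /andP[v1 v2]; apply: IH; apply/andP; split; lra.
have bnd0 u : 0 <= u -> `|expsum h u| <= U.
  move=> u0; apply: (bnd (Num.truncn (u / s)).+1); rewrite u0/=.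
  have := truncnS_gt (u / s).
  rewrite ltr_pdivrMr// mulr_natl => /ltW; lra.
elim=> [|j IH] t jt; first by rewrite expr0 divr1 bnd0// (le_trans _ jt).
rewrite exprSr invfM mulrA.
have sj : 0 <= s * D%:R *+ j by rewrite mulrn_wge0// ltW.
rewrite mulrSr in jt.
apply: halve; [lra|by rewrite divr_ge0// exprn_ge0|].
by move=> u /andP[u1 u2]; apply: IH; lra.
Qed.

Lemma expsum_size0 h t : size h = 0%N -> expsum h t = 0.
Proof. by move=> /size0nil ->; rewrite /expsum big_nil. Qed.

(** The operator f - e^(gs) f(. + s) annihilates the term of exponent g = [p.2]; the inductions on
    the number of exponents use it to drop the head. *)
Lemma expsum_second_diff (p : R * R) h s t :
  expsum (act (fun x => 1 - expR (p.2 * s) * expR (- (s * x))) h) t =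
  expsum (p :: h) t - expR (p.2 * s) * expsum (p :: h) (t + s).
Proof.
rewrite expsum_act /expsum !big_cons mulrDr opprD addrACA.
have -> : p.1 * expR (- (p.2 * t)) -
    expR (p.2 * s) * (p.1 * expR (- (p.2 * (t + s)))) = 0.
  rewrite mulrCA -expRD mulrDr opprD [p.2 * s + _]addrC subrK.
  by rewrite subrr.
rewrite add0r mulr_sumr -sumrB; apply: eq_bigr => q _.
by rewrite [q.2 * (t + s)]mulrDr [- (_ + _)]opprD expRD [q.2 * s]mulrC; ring.
Qed.

Lemma expR_half_le2 (x : R) : x <= 2^-1 -> expR x <= 2.
Proof.
move=> x2; rewrite -[x]opprK expRN invf_ple ?posrE ?expR_gt0//.
by apply: le_trans (expR_ge1Dx _); lra.
Qed.

Lemma expR_le1D2 (x : R) : 0 <= x <= 2^-1 -> expR x <= 1 + x *+ 2.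
Proof.
move=> /andP[x0 x2]; rewrite -[x in leLHS]opprK expRN invf_ple ?posrE ?expR_gt0//; last lra.
apply: le_trans (expR_ge1Dx _); rewrite -div1r ler_pdivrMr; last lra.
by nra.
Qed.

(** Backward extrapolation: dropping the head exponent by a difference involves a factor w <= 2,
    which costs a factor 4 per exponent in all. The sum starts at j = 1, so that every sampling
    point moves with s and can later be averaged over s. *)
Lemma expsum_nikolskii b h s t : 0 <= s -> s * b <= 2^-1 ->
  {in h, forall p, p.2 <= b} ->
  `|expsum h t| <= 4 ^+ size h * \sum_(1 <= j < (size h).+1) `|expsum h (t + s *+ j)|.
Proof.
move=> s0 sb.
have [n] := ubnP (size h); elim: n h => // n IH [|p h] hn hb.
  by rewrite expsum_size0 ?normr0// expr0 mul1r big_geq.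
set A := fun j => `|expsum (p :: h) (t + s *+ j)| : R.
set w := expR (p.2 * s).
have w2 : w <= 2.
  apply: expR_half_le2; apply: le_trans sb.
  by rewrite mulrC ler_wpM2l// hb// mem_head.
set v := act (fun x => 1 - w * expR (- (s * x))) h.
have vE u : expsum v u = expsum (p :: h) u - w * expsum (p :: h) (u + s).
  exact: expsum_second_diff.
have sv : size v = size h by rewrite size_map.
have vb : {in v, forall q, q.2 <= b}.
  by move=> q /mapP[q' qh ->]/=; apply: hb; rewrite inE qh orbT.
have := IH v; rewrite sv => /(_ hn vb); set m := size h => Hv.
have A0 j : 0 <= A j by exact: normr_ge0.
have S1 : \sum_(1 <= j < m.+1) `|expsum v (t + s *+ j)| <=
    \sum_(1 <= j < m.+1) (A j + 2 * A j.+1).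
  apply: ler_sum => j _; rewrite vE (le_trans (ler_normB _ _))// lerD// normrM.
  rewrite (ger0_norm (expR_ge0 _)) /A [s *+ j.+1]mulrSr addrA; exact: ler_wpM2r.
have H0 : `|expsum (p :: h) t| <= `|expsum v t| + 2 * A 1%N.
  have -> : expsum (p :: h) t = expsum v t + w * expsum (p :: h) (t + s) by rewrite (vE t) addrNK.
  rewrite (le_trans (ler_normD _ _))// lerD// normrM.
  by rewrite (ger0_norm (expR_ge0 _)) /A mulr1n; exact: ler_wpM2r.
apply: le_trans H0 _.
have S2 : \sum_(1 <= j < m.+1) A j <= \sum_(1 <= j < m.+2) A j.
  by rewrite [leRHS]big_nat_recr//= lerDl.
have S3 : \sum_(1 <= j < m.+1) A j.+1 = \sum_(1 <= j < m.+2) A j - A 1%N.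
  by rewrite [in RHS]big_nat_recl// addrAC subrr add0r big_add1.
rewrite big_split/= -mulr_sumr S3 in S1.
set T := \sum_(1 <= j < m.+2) A j in S2 S3 S1 *.
set X := \sum_(1 <= j < m.+1) A j in S1 S2.
set Y := \sum_(1 <= j < m.+1) `|_| in S1 Hv.
have e0 : 1 <= 4 ^+ m :> R by rewrite exprn_ege1// ler1n.
have HY : `|expsum v t| <= 4 ^+ m * (T + 2 * (T - A 1%N)).
  apply: le_trans Hv _; rewrite ler_pM2l ?exprn_gt0//.
  by lra.
rewrite exprS -/m -/T.
have A1T : A 1%N <= T.
  by rewrite /T big_nat_recl//= lerDl sumr_ge0.
have := A0 1%N; move: (A 1%N) HY A1T e0 => x HY A1T e0 x0.
set E := 4 ^+ m in HY e0 *.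
have : 0 <= (E - 1) * x by rewrite mulr_ge0// subr_ge0.
have : 0 <= E * T by rewrite mulr_ge0//; lra.
lra.
Qed.
End Laplace.

(** * Bernstein inequality *)

Section Bernstein.
Variable R : realType.
Implicit Types (h : seq (R * R)) (b d t U : R).

(* Landau's argument: if the second difference is small compared with the
   first, then the first difference is small compared with the function. *)
Lemma landau_difference (f : R -> R) (k om e U d : R) (n : nat) t : 0 <= d ->
  0 <= t -> (0 < n)%N -> 0 <= e ->
  (forall u, 0 <= u -> `|f u| <= U) ->
  (forall u, 0 <= u ->
     `|(f (u + d) - f (u + d + d)) - (f u - f (u + d))| <= e) ->
  `|f t - f (t + d)| <= 2 * U / n%:R + n%:R * e.
Proof.
move=> d0 t0 n0 e0 fU fe.
pose D u := f u - f (u + d).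
have td i : 0 <= t + d *+ i by rewrite addr_ge0// mulrn_wge0.
have near i : `|D (t + d *+ i) - D t| <= e *+ i.
  elim: i => [|i IH]; first by rewrite !mulr0n addr0 subrr normr0.
  rewrite !mulrSr addrA.
  rewrite (_ : _ - _ = (D (t + d *+ i + d) - D (t + d *+ i)) + (D (t + d *+ i) - D t)).
    by rewrite addrC (le_trans (ler_normD _ _))// lerD// fe.
  by rewrite addrA subrK.
have tel m : \sum_(0 <= i < m) D (t + d *+ i) = f t - f (t + d *+ m).
  elim: m => [|m IH]; first by rewrite big_geq// mulr0n addr0 subrr.
  by rewrite big_nat_recr//= IH /D subrKA [d *+ m.+1]mulrSr addrA.
have nR : 0 < n%:R :> R by rewrite ltr0n.
have H : `|D t *+ n| <= 2 * U + e *+ n *+ n.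
  have -> : D t *+ n = (f t - f (t + d *+ n)) - \sum_(0 <= i < n) (D (t + d *+ i) - D t).
    by rewrite sumrB tel big_const_nat subn0 iter_addr_0 subKr.
  rewrite (le_trans (ler_normB _ _))// lerD//.
    by rewrite (le_trans (ler_normB _ _))// mulr_natl mulr2n lerD// fU.
  rewrite (le_trans (ler_norm_sum _ _ _))//.
  have -> : e *+ n *+ n = \sum_(0 <= i < n) e *+ n.
    by rewrite big_const_nat subn0 iter_addr_0.
  by apply: ler_sum_nat => i /andP[_ iN]; rewrite (le_trans (near i))// ler_wpMn2l// ltnW.
rewrite normrMn -[`|D t| *+ n]mulr_natr -[e *+ n *+ n]mulr_natr -[e *+ n]mulr_natr in H.
rewrite -(ler_pM2r nR) (le_trans H)// (mulrDl (2 * U / n%:R)) divfK ?gt_eqF// lerD2l.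
by rewrite [n%:R * e]mulrC.
Qed.

(** Induction on the number of exponents: for v = f - e^(gd) f(. + d), which has one exponent less,
    the differences are small, hence so are the second differences of f, and Landau's argument
    bounds the first ones. The constant depends on n only, not on the gaps between exponents. *)
Lemma expsum_bernstein n : exists2 C : R, 0 <= C &
  forall b h U d, 0 < b -> 0 < d -> (size h <= n)%N ->
    {in h, forall p, 0 <= p.2 <= b} ->
    (forall t, 0 <= t -> `|expsum h t| <= U) ->
    forall t, 0 <= t -> `|expsum h t - expsum h (t + d)| <= C * (b * d) * U.
Proof.
elim: n => [|n [C C0 IH]].
  exists 0 => // b h U d b0 d0; rewrite leqn0 => /eqP h0 _ _ t t0.
  by rewrite !expsum_size0// subrr normr0 !mul0r.
exists (16 * (1 + C) + 2); first by lra.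
move=> b [|p h] U d b0 d0 hn hb hU.
  move=> t t0; have U0 := le_trans (normr_ge0 _) (hU 0 (lexx 0)).
  by rewrite !expsum_size0// subrr normr0 !mulr_ge0// ?ltW//; lra.
have U0 : 0 <= U := le_trans (normr_ge0 _) (hU 0 (lexx 0)).
set f := expsum (p :: h) in hU *.
have hd2 t : 0 <= t -> `|f t - f (t + d)| <= 2 * U.
  move=> t0; rewrite mulr_natl mulr2n (le_trans (ler_normB _ _))// lerD// hU//.
  by rewrite addr_ge0// ltW.
set x := b * d.
have x0 : 0 < x by rewrite mulr_gt0.
(* Chosen so that, with about eta / x steps, the Landau bound has a coefficient at most 1/2 in front
   of [om]. *)
set eta := (2 * (1 + C))^-1.
have eta0 : 0 < eta by rewrite invr_gt0; lra.
have etaC : eta * (1 + C) = 2^-1 by rewrite /eta invfM mulfVK//; lra.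
have etale : eta <= 2^-1 by rewrite -etaC ler_pMr//; lra.
(* For x = b d above eta the trivial bound 2 U is already of order x U. *)
have [xeta|xeta] := ltP eta x => [t t0|].
  apply: le_trans (hd2 t t0) _; apply: ler_wpM2r => //.
  have : eta * (1 + C) <= x * (1 + C) by rewrite ler_pM2r; lra.
  rewrite etaC; lra.
(* This supremum is finite, so half of it can be moved to the left side at the end. *)
pose om := sup [set y | exists2 t, 0 <= t & y = `|f t - f (t + d)|].
have om_ub t : 0 <= t -> `|f t - f (t + d)| <= om.
  move=> t0; apply: sup_upper_bound; last by exists t.
  split; first by exists `|f 0 - f (0 + d)|; exists 0.
  by exists (2 * U) => _ [u u0 ->]; exact: hd2.
have om0 : 0 <= om := le_trans (normr_ge0 _) (om_ub 0 (lexx 0)).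
have /andP[g0 gb] : 0 <= p.2 <= b by apply: hb; rewrite mem_head.
set w := expR (p.2 * d).
have gd : 0 <= p.2 * d <= x by rewrite mulr_ge0 ?(ltW d0)//= ler_wpM2r // ltW.
have w1 : 1 <= w by rewrite -expR0 ler_expR; case/andP: gd.
have w2 : w <= 1 + x *+ 2.
  apply: le_trans (expR_le1D2 _) _; lra.
have z1 : w^-1 <= 1 by rewrite invf_le1//; lra.
have z2 : 1 - x <= w^-1.
  rewrite -expRN; apply: le_trans (expR_ge1Dx _); lra.
set v := act (fun y => 1 - w * expR (- (d * y))) h.
have vE t : expsum v t = f t - w * f (t + d) by exact: expsum_second_diff.
have vU t : 0 <= t -> `|expsum v t| <= om + 2 * x * U.
  move=> t0; rewrite vE (_ : _ - _ = (f t - f (t + d)) - (w - 1) * f (t + d)); last by ring.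
  rewrite (le_trans (ler_normB _ _))// lerD ?om_ub// normrM ler_pM//.
    by rewrite ger0_norm; lra.
  by rewrite hU// addr_ge0// ltW.
have vb : {in v, forall q, 0 <= q.2 <= b}.
  by move=> q /mapP[q' qh ->]/=; apply: hb; rewrite inE qh orbT.
have sv : (size v <= n)%N by rewrite size_map.
have {IH}IH := IH b v _ d b0 d0 sv vb vU.
rewrite -/x in IH.
set e := C * x * (om + 2 * x * U) in IH.
have xU : 0 <= x * U by rewrite mulr_ge0// ltW.
have e0 : 0 <= e by apply: mulr_ge0; [rewrite mulr_ge0 // ltW|lra].
have step u : 0 <= u ->
    `|(f (u + d) - f (u + d + d)) - (f u - f (u + d))| <= x * om + e.
  move=> u0; rewrite (_ : _ - _ = - ((1 - w^-1) * (f u - f (u + d)))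
      - w^-1 * (expsum v u - expsum v (u + d))); last first.
    rewrite !vE; field; lra.
  rewrite (le_trans (ler_normB _ _))// normrN !normrM lerD//.
    rewrite ler_pM// ?om_ub//; rewrite ger0_norm; lra.
  rewrite -[e]mul1r ler_pM// ?IH// ger0_norm// invr_ge0; lra.
pose N := Num.truncn (eta / x).
have /andP[N1 N2] := truncn_itv (divr_ge0 (ltW eta0) (ltW x0)).
rewrite -/N in N1 N2.
have N0 : (0 < N)%N.
  by rewrite /N truncn_gt0 ler_pdivlMr// mul1r.
have NR : 1 <= N%:R :> R by rewrite ler1n.
rewrite ler_pdivlMr// in N1.
rewrite ltr_pdivrMr// -natr1 in N2.
have Ninv : N%:R^-1 <= 2 * x / eta.
  rewrite -div1r ler_pdivrMr; last lra.
  rewrite mulrAC ler_pdivlMr// mul1r.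
  have : x <= N%:R * x by rewrite ler_peMl// ltW.
  lra.
have xom : 0 <= x * om + e by rewrite addr_ge0// mulr_ge0// ltW.
have main t : 0 <= t -> `|f t - f (t + d)| <= 2 * U * (2 * x / eta) + om / 2 + x * U.
  move=> t0.
  have := @landau_difference f 0 0 _ U d N t (ltW d0) t0 N0 xom hU step.
  move=> /le_trans; apply; rewrite -addrA lerD//.
    by rewrite ler_wpM2l//; lra.
  have : N%:R * x * ((1 + C) * om + C * (2 * x * U)) <=
         eta * ((1 + C) * om + C * (2 * x * U)).
    apply: ler_wpM2r => //; rewrite addr_ge0// mulr_ge0//; lra.
  have -> : eta * ((1 + C) * om + C * (2 * x * U)) =
     (eta * (1 + C)) * om + (eta * (1 + C)) * (2 * x * U) - eta * (2 * x * U) by ring.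
  have : 0 <= eta * (2 * x * U) by rewrite mulr_ge0//; lra.
  rewrite etaC /e; lra.
have : om <= 2 * U * (2 * x / eta) + om / 2 + x * U.
  apply: ge_sup; first by exists `|f 0 - f (0 + d)|; exists 0.
  by move=> _ [t t0 ->]; exact: main.
have -> : 2 * U * (2 * x / eta) = 8 * (1 + C) * (x * U).
  by rewrite /eta invrK; ring.
move=> oml t t0; apply: le_trans (om_ub t t0) _.
rewrite -mulrA; lra.
Qed.
End Bernstein.

(** * Projection onto a block *)

Section Projector.
Variable R : realType.

Lemma prod_1D_le2 (I : eqType) (r : seq I) (x : I -> R) :
  {in r, forall i, 0 <= x i} -> \sum_(i <- r) x i <= 2^-1 ->
  \prod_(i <- r) (1 + x i) <= 2 /\ 2^-1 <= \prod_(i <- r) (1 - x i).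
Proof.
move=> x0 sx.
(* The Weierstrass product inequalities, in a form that carries through the induction. *)
have [A B C] : [/\ 0 <= \prod_(i <- r) (1 + x i),
    \prod_(i <- r) (1 + x i) * (1 - \sum_(i <- r) x i) <= 1 &
    1 - \sum_(i <- r) x i <= \prod_(i <- r) (1 - x i)].
  elim: r x0 sx => [|i r IH] x0 sx; first by rewrite !big_nil subr0 mulr1.
  have xi : 0 <= x i by rewrite x0// mem_head.
  have xr : {in r, forall j, 0 <= x j} by move=> j jr; rewrite x0// inE jr orbT.
  have S0 : 0 <= \sum_(j <- r) x j by rewrite big_seq sumr_ge0.
  rewrite big_cons in sx.
  have [|A B C] := IH xr; first by lra.
  rewrite !big_cons; move: S0 sx A B C.
  set S := \sum_(j <- r) x j; set P := \prod_(j <- r) (1 + x j).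
  set P' := \prod_(j <- r) _ => S0 sx A B C; split.
  - by rewrite mulr_ge0//; lra.
  - have : P * (x i * (x i + S)) >= 0 by rewrite !mulr_ge0//; lra.
    lra.
  - have : (1 - x i) * (1 - S) <= (1 - x i) * P' by rewrite ler_wpM2l//; lra.
    have : 0 <= x i * S by rewrite mulr_ge0.
    lra.
split; last lra.
have : \prod_(i <- r) (1 + x i) * 2^-1 <= \prod_(i <- r) (1 + x i) * (1 - \sum_(i <- r) x i).
  by rewrite ler_wpM2l//; lra.
lra.
Qed.

(* 1 - prod_g (1 - A/A(g)) is divisible by A and equals 1 on the block, however
   close to each other the exponents of the block are. *)
Lemma laplace_interpolation_one (A : R -> R) beta S alpha (bl : seq R) :
  0 < beta -> 0 <= S -> 0 < alpha ->
  laplace beta S A -> {in bl, forall g, alpha <= A g} ->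
  exists2 Q, laplace (((1 + alpha^-1 * beta) ^+ size bl - 1) / beta)
      (S *+ size bl) Q
    & forall x, 1 - A x * Q x = \prod_(g <- bl) (1 - A x / A g).
Proof.
move=> b0 S0 a0 LA; elim: bl => [|g bl IH] Abl.
  exists (fun=> 0); first by rewrite expr0 subrr mul0r; exact: laplace0.
  by move=> x; rewrite big_nil mulr0 subr0.
have [|Q LQ HQ] := IH; first by move=> x xb; rewrite Abl// inE xb orbT.
have Ag : alpha <= A g by rewrite Abl// mem_head.
have Ag0 : 0 < A g := lt_le_trans a0 Ag.
(* This is (1 - (1 - A Q)(1 - A / A(g))) / A. With k = 1/alpha its norm bound obeys m' = k + m + k
   beta m, which is solved by ((1 + k beta)^n - 1) / beta. *)
exists (fun x => (A g)^-1 + (Q x + (- (A g)^-1) * (A x * Q x))).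
  have mQ := laplace_ge0 LQ.
  have kk : (A g)^-1 <= alpha^-1 by rewrite lef_pV2// posrE.
  have k0 : 0 <= (A g)^-1 by rewrite invr_ge0 ltW.
  set m := _ / beta in LQ mQ.
  apply: (@laplace_le _ _ _ ((A g)^-1 + (m + (A g)^-1 * (beta * m))) (S *+ (size bl).+1)) => //.
    have -> : ((1 + alpha^-1 * beta) ^+ size (g :: bl) - 1) / beta =
        alpha^-1 + (m + alpha^-1 * (beta * m)).
      rewrite /m /= exprS; field; lra.
    by rewrite lerD// lerD2l ler_wpM2r// mulr_ge0 // ltW.
  have Sn : 0 <= S *+ size bl by rewrite mulrn_wge0.
  apply: laplaceD.
    apply: laplace_le (laplace_cst _) => //; first by rewrite ger0_norm.
    by rewrite mulrn_wge0.
  apply: laplaceD; first by apply: laplace_le LQ => //; rewrite mulrSr lerDl.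
  rewrite -[X in X * _](ger0_norm k0) -normrN; apply: laplaceZ.
  by rewrite mulrS; exact: laplaceM.
move=> x; rewrite big_cons -HQ; field; lra.
Qed.

Lemma laplace_difference (d : R) r : 0 <= d ->
  laplace (2 ^+ r) (r%:R * d) (fun y => (1 - expR (- (d * y))) ^+ r).
Proof.
move=> d0; rewrite mulr_natl; apply: laplaceX; rewrite -[X in laplace X]/(1 + 1).
apply: (@laplaceD _ _ _ _ (fun=> 1) (fun y => - expR (- (d * y)))).
  by apply: laplace_le (laplace_cst _); rewrite ?normr1.
have := laplaceZ (-1) (laplace_shift d0); rewrite normrN normr1 mulr1.
by apply: laplace_eq => y; rewrite mulN1r.
Qed.

Lemma expRN1_le : expR (- 1) <= 2^-1 :> R.
Proof. by rewrite expRN lef_pV2 ?posrE ?expR_gt0// -natr1; exact: expR_ge1Dx. Qed.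

(** With T y = e^(-y/a), the factor H annihilates the higher exponents, W the near lower ones, and Q
    corrects the product A = T (1 - T)^r H W to 1 on the block. The order of the quantifiers
    matters: [N2] is independent of r and K, [N1] of K, and no constant depends on how many
    exponents lie above the block. *)
Lemma block_projector (D : nat) (q M S0 : R) : 1 < q -> 1 <= M -> 0 <= S0 ->
  exists2 N2, 1 <= N2 & forall r, exists2 N1, 0 <= N1 &
  forall K, exists2 L, 0 <= L & forall (I : eqType) (a : R) (bl nr : seq R)
    (hi : seq I) (s g x : I -> R), 0 < a ->
    (size bl <= D)%N -> {in bl, forall c, a <= c <= M * a} ->
    (size nr <= K * D)%N -> {in nr, forall c, 0 <= c /\ q * c <= a} ->
    {in hi, forall i, [/\ 0 <= s i, 0 <= x i, expR (- (s i * g i)) <= x i &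
      {in bl, forall c, expR (- (s i * (g i - c))) <= x i}]} ->
    \sum_(i <- hi) s i <= S0 / a -> \sum_(i <- hi) x i <= 2^-1 ->
  exists2 G, laplace (N1 * N2 ^+ K) (L / a) G &
    let Phi c := expR (- (a^-1 * c)) * (1 - expR (- (a^-1 * c))) ^+ r * G c in
    [/\ {in bl, forall c, Phi c = 1}, {in nr, forall c, Phi c = 0}
      & {in hi, forall i, Phi (g i) = 0}].
Proof.
move=> q1 M1 S00.
(* A factor 1 - e^(c/a) T of W has c <= a, hence norm at most [e1]; since moreover q c <= a, it is
   at least [c1] on the block. *)
set e1 : R := 1 + expR 1.
have e11 : 1 <= e1 by rewrite lerDl expR_ge0.
set c1 : R := 1 - expR (- (1 - q^-1)).
have iq : q^-1 < 1 by rewrite invf_lt1//; lra.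
have iq0 : 0 < q^-1 by rewrite invr_gt0; lra.
have c10 : 0 < c1 by rewrite subr_gt0 -[X in _ < X]expR0 ltr_expR; lra.
have c11 : c1 <= 1 by rewrite lerBlDr lerDl expR_ge0.
have ec1 : 1 <= e1 / c1 by rewrite ler_pdivlMr// mul1r; lra.
exists (e1 ^+ D * ((e1 / c1) ^+ D) ^+ D).
  by rewrite mulr_ege1// !exprn_ege1.
(* Twice the ratio beta / alpha below, without its power of [e1 / c1]. *)
move=> r; set k := 4 ^+ r * (8 * expR (M + M * S0)).
have k0 : 0 <= k by rewrite !mulr_ge0 ?exprn_ge0 ?expR_ge0.
exists (2 * k ^+ D); first by rewrite mulr_ge0 ?exprn_ge0.
move=> K.
set S1 : R := 1 + r%:R + S0 + (K * D)%:R.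
have S10 : 0 <= S1 by rewrite !addr_ge0.
exists (S0 + (K * D)%:R + S1 *+ D); first by rewrite !addr_ge0// mulrn_wge0.
move=> I a bl nr hi s g x a0 bD bM nD nq hi1 hs hx.
have ia0 : 0 < a^-1 by rewrite invr_gt0.
set n := (K * D)%N in nD S1 S10 *.
pose T y := expR (- (a^-1 * y)).
pose H y := \prod_(i <- hi) (expR (- (s i * y)) + - expR (- (s i * g i))).
pose W y := \prod_(c <- nr) (1 + - expR (a^-1 * c) * T y).
have LT : laplace 1 a^-1 T by apply: laplace_shift; rewrite ltW.
have LH : laplace 2 (S0 / a) H.
  have [|P2 _] := prod_1D_le2 _ hx; first by move=> i /hi1[].
  apply: (@laplace_le _ _ _ (\prod_(i <- hi) (1 + x i)) (\sum_(i <- hi) s i)) => //.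
  apply: laplace_prod => i /hi1[si xi ex _]; apply: laplaceD; first exact: laplace_shift.
  by apply: laplace_le (laplace_cst _) => //; rewrite normrN ger0_norm ?expR_ge0.
have LW : laplace (e1 ^+ n) (n%:R / a) W.
  apply: (@laplace_le _ _ _ (\prod_(c <- nr) e1) (\sum_(c <- nr) a^-1)).
  - by rewrite big_const_seq count_predT iter_mulr_1 ler_weXn2l.
  - rewrite big_const_seq count_predT iter_addr_0 mulr_natl.
    by rewrite ler_wpMn2l// ltW.
  apply: laplace_prod => c /nq[c0 cq]; apply: laplaceD.
    by apply: laplace_le (laplace_cst _); rewrite ?normr1// ltW.
  apply: laplace_le (laplaceZ _ LT) => //.
  rewrite normrN ger0_norm ?expR_ge0// mulr1 ler_expR mulrC ler_pdivrMr// mul1r.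
  by apply: le_trans cq; rewrite ler_peMl// ltW.
have LD : laplace (2 ^+ r) (r%:R / a) (fun y => (1 - T y) ^+ r).
  exact: laplace_difference (ltW ia0).
pose A y := T y * (1 - T y) ^+ r * (H y * W y).
set beta : R := 1 * 2 ^+ r * (2 * e1 ^+ n).
have LA : laplace beta (S1 / a) A.
  have -> : S1 / a = a^-1 + r%:R / a + (S0 / a + n%:R / a) by rewrite /S1; field; lra.
  by apply: laplaceM; apply: laplaceM.
have beta0 : 0 < beta by rewrite !mulr_gt0 ?exprn_gt0//; lra.
(* Product of lower bounds on the block: T >= e^(-M), 1 - T >= 1/2, H >= e^(-M S0) / 2 and W >=
   c1^n. *)
set alpha := expR (- M) * (2^-1) ^+ r * ((expR (- (M * S0)) / 2) * c1 ^+ n).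
have alpha0 : 0 < alpha by rewrite !mulr_gt0 ?exprn_gt0 ?expR_gt0.
have Aalpha : {in bl, forall c, alpha <= A c}.
  move=> c cb; have /andP[ac cM] := bM c cb.
  have c0 : 0 < c := lt_le_trans a0 ac.
  have aM : a^-1 * c <= M by rewrite mulrC ler_pdivrMr.
  have ac1 : 1 <= a^-1 * c by rewrite mulrC ler_pdivlMr// mul1r.
  have T2 : T c <= 2^-1.
    by apply: le_trans expRN1_le; rewrite ler_expR lerN2.
  rewrite /alpha /A; apply: ler_pM; first by rewrite mulr_ge0 ?exprn_ge0 ?expR_ge0.
  - by rewrite !mulr_ge0 ?exprn_ge0 ?expR_ge0// ltW.
  - apply: ler_pM; rewrite ?exprn_ge0 ?expR_ge0//.
      by rewrite ler_expR lerN2.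
    by apply: lerXn2r; rewrite ?nnegrE; lra.
  apply: ler_pM; rewrite ?mulr_ge0 ?exprn_ge0 ?expR_ge0 ?(ltW c10)//.
  - have -> : H c = \prod_(i <- hi) expR (- (s i * c)) *
       \prod_(i <- hi) (1 - expR (- (s i * (g i - c)))).
      rewrite -big_split/=; apply: eq_bigr => i _.
      by rewrite mulrBr mulr1 -expRD; congr (_ - expR _); ring.
    apply: ler_pM; rewrite ?expR_ge0 ?invr_ge0//.
      rewrite -expR_sum ler_expR sumrN lerN2 -mulr_suml.
      apply: (@le_trans _ _ (S0 / a * c)); first by rewrite ler_wpM2r// ltW.
      by rewrite mulrAC -mulrA [M * _]mulrC ler_wpM2l// ler_pdivrMr.
    have [||_ P2] := @prod_1D_le2 _ hi (fun i => expR (- (s i * (g i - c)))) _ _.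
    + by move=> i _; exact: expR_ge0.
    + apply: le_trans hx; rewrite big_seq [leRHS]big_seq; apply: ler_sum => i /hi1[_ _ _].
      exact.
    + exact: P2.
  - apply: (@le_trans _ _ (c1 ^+ size nr)); first by apply: ler_wiXn2l => //; exact: ltW.
    rewrite /W.
    have -> : c1 ^+ size nr = \prod_(c <- nr) c1.
      by rewrite big_const_seq count_predT iter_mulr_1.
    rewrite big_seq [leRHS]big_seq; apply: ler_prod => d /nq[d0 dq].
    rewrite (ltW c10)/= lerD2l mulNr lerN2 /T -expRD ler_expR.
    rewrite -mulrBr mulrC -[d - c]opprB mulNr lerN2 ler_pdivlMr//.
    have : d <= q^-1 * a by rewrite mulrC ler_pdivlMr; lra.
    lra.
have [Q LQ HQ] := laplace_interpolation_one beta0 (divr_ge0 S10 (ltW a0)) alpha0 LA Aalpha.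
exists (fun y => (H y * W y) * Q y); last first.
  have PhiE y : T y * (1 - T y) ^+ r * (H y * W y * Q y) = A y * Q y.
    by rewrite /A !mulrA.
  split=> c cb; rewrite -/(T _) PhiE.
  - apply/eqP; rewrite eq_sym -subr_eq0 HQ (big_rem c)//= divff ?subrr ?mul0r//.
    by rewrite gt_eqF// (lt_le_trans alpha0)// Aalpha.
  - rewrite /A /W (big_rem c)//= mulNr /T -expRD addrN expR0 subrr.
    by rewrite mul0r !mulr0 mul0r.
  - by rewrite /A /H (big_rem c)//= subrr mul0r !(mulr0, mul0r).
apply: laplace_le (laplaceM (laplaceM LH LW) LQ); last first.
  rewrite -mulrDl [leRHS]mulrDl lerD2l -mulrnAl ler_pM2r//.
  by rewrite ler_wpMn2l.
set kb := alpha^-1 * beta.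
have kbE : 2 * kb = k * (e1 / c1) ^+ n.
  rewrite /kb /alpha /beta /k expRD -[4]/(2 * 2)%:R natrM exprMn expr_div_n exprVn !expRN.
  by field; rewrite ?gt_eqF ?exprn_gt0 ?expR_gt0.
have kb1 : 1 <= kb.
  have : 8 <= 2 * kb; last by lra.
  rewrite kbE /k -[leLHS]mul1r; apply: (@le_trans _ _ (1 * (8 * 1) * 1)); first lra.
  apply: ler_pM => //; last by rewrite exprn_ege1.
  apply: ler_pM => //; first by rewrite exprn_ege1// ler1n.
  by rewrite ler_pM2l// -expR0 ler_expR addr_ge0// ?mulr_ge0//; lra.
(* The ratio [kb] is of order (e1/c1)^(K D) and is raised to the power D by the interpolation, which
   is why [N2] contains (e1/c1)^(D^2). *)
apply: (@le_trans _ _ (2 * e1 ^+ n * (2 * kb) ^+ D)).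
  rewrite ler_wpM2l ?mulr_ge0 ?exprn_ge0//; first by lra.
  rewrite ler_pdivrMr//.
  have : (1 + kb) ^+ size bl <= (2 * kb) ^+ D.
    apply: (@le_trans _ _ ((2 * kb) ^+ size bl)).
      by apply: lerXn2r; rewrite ?nnegrE; lra.
    by apply: ler_weXn2l => //; lra.
  have : (2 * kb) ^+ D * 1 <= (2 * kb) ^+ D * beta.
    rewrite ler_wpM2l ?exprn_ge0//; first by lra.
    rewrite /beta mul1r mulr_ege1 ?exprn_ege1 ?ler1n//.
    by have := exprn_ege1 n e11; lra.
  lra.
rewrite kbE exprMn -!exprM !exprMn -!exprM !mulrA.
rewrite (mulnC D K) -/n (_ : (D * D * K = n * D)%N); last by rewrite /n mulnC mulnA.
by rewrite le_eqVlt; apply/orP; left; apply/eqP; ring.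
Qed.
End Projector.

(** * Geometric tails *)

Section GeometricSums.
Variable R : realType.

Lemma geometric_tail (q : R) k n : 1 < q ->
  \sum_(0 <= j < n | (k < j)%N) (q ^+ (j - k))^-1 <= (q - 1)^-1.
Proof.
move=> q1.
(* Truncated subtraction makes the closed form vanish as well when the sum is empty. *)
have -> : \sum_(0 <= j < n | (k < j)%N) (q ^+ (j - k))^-1 =
    (1 - (q ^+ (n.-1 - k))^-1) / (q - 1).
  elim: n => [|n IH]; first by rewrite big_geq// sub0n expr0 invr1 subrr mul0r.
  rewrite big_mkcond big_nat_recr//= -big_mkcond IH /=.
  case: ifPn => [kn|].
    have -> : (n - k = (n.-1 - k).+1)%N by lia.
    rewrite exprS; field; rewrite ?gt_eqF ?exprn_gt0 ?subr_gt0//; lra.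
  by rewrite -leqNgt addr0 => nk; have [-> ->] : (n.-1 - k = 0 /\ n - k = 0)%N by lia.
rewrite ler_pdivrMr ?subr_gt0// mulVf; last lra.
by rewrite gerBl invr_ge0 exprn_ge0//; lra.
Qed.
End GeometricSums.

Ltac nlia := repeat match goal with
  | H : is_true (Order.le _ _) |- _ => clear H
  | H : is_true (Order.lt _ _) |- _ => clear H
  | H : forall _, is_true (Order.lt _ _) |- _ => clear H
  | H : forall _, is_true (Order.le _ _) |- _ => clear H
  end; lia.

(** * Cutting a quasilacunary sequence into blocks *)

Section Blocks.
Variable R : realType.

(* The blocks end at the indices i with q * lam i <= lam i.+1. *)
Lemma quasilacunary_blocks (lam : nat -> R) :
  (forall n, 0 < lam n) -> {homo lam : m n / (m < n)%N >-> m < n} ->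
  quasilacunary lam ->
  exists (blk st : nat -> nat) (q M : R) (D : nat),
  [/\ 1 < q, 1 <= M, (0 < D)%N &
   [/\ forall i, (blk i <= i)%N,
      forall i j, (blk i < blk j)%N -> q ^+ (blk j - blk i) * lam i <= lam j,
      forall k, blk (st k) = k,
      forall i, lam (st (blk i)) <= lam i <= M * lam (st (blk i))
    & forall N k, (size [seq i <- iota 0 N | blk i == k] <= D)%N]].
Proof.
move=> lam0 lami [n [q0 [ni q01 nq [B nB]]]].
(* With q = 1 + x this gives q^B - 1 <= 2 B x <= q0 - 1, so at most B consecutive ratios below q
   cannot make up the factor q0. The minimum with 1 ensures B x <= 1/2, as [exprD1_le] requires. *)
pose x := Num.min 1 (q0 - 1) / (2 * (B.+1)%:R).
have B0 : 0 < 2 * (B.+1)%:R :> R by rewrite mulr_gt0.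
have x0 : 0 < x by rewrite divr_gt0// lt_min ltr01/=; lra.
have xB : x *+ B *+ 2 <= Num.min 1 (q0 - 1).
  apply: (@le_trans _ _ (x *+ B.+1 *+ 2)).
    by rewrite lerMn2r/= ler_wpMn2l// ltW.
  rewrite le_eqVlt -mulrnA -[_ *+ _]mulr_natr natrM mulrC.
  by rewrite [_%:R * 2]mulrC /x mulrCA divff ?mulr1 ?eqxx ?gt_eqF.
have [xB1 xB2] : x *+ B *+ 2 <= 1 /\ x *+ B *+ 2 <= q0 - 1.
  by move: xB; rewrite le_min => /andP[].
pose q := 1 + x.
have q1 : 1 < q by rewrite ltrDl.
have q_gt0 : 0 < q by lra.
have qB : q ^+ B <= q0.
  have : q ^+ B - 1 <= x *+ B *+ 2 by apply: exprD1_le; lra.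
  lra.
pose cut i := q * lam i <= lam i.+1.
(* From any index, some n_k is at most n_0 + B further on, and a cut follows within the next B
   indices. *)
pose D := (n 0 + B + B)%N.
have near i : exists k, (i <= n k <= i + (n 0 + B))%N.
  elim: i => [|i [k /andP[ik ki]]]; first by exists 0%N; nlia.
  have [ik'|ki'] := leqP i.+1 (n k); first by exists k; nlia.
  by exists k.+1; have := nB k; have := ni k k.+1 (ltnSn k); nlia.
have uncut i m : (forall j, (i <= j < i + m.+1)%N -> ~~ cut j) ->
    lam (i + m.+1)%N < q ^+ m.+1 * lam i.
  elim: m => [|m IH] H.
    by rewrite addn1 expr1 ltNge; apply: (H i); rewrite leqnn addn1 ltnSn.
  have b : (i <= i + m.+1 < i + m.+2)%N by rewrite leq_addr ltn_add2l ltnSn.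
  have := H _ b; rewrite /cut -ltNge -addnS => /lt_trans; apply.
  rewrite [q ^+ m.+2]exprS -mulrA ltr_pM2l//; apply: IH => j /andP[ij jm].
  by apply: H; rewrite ij addnS ltnW.
have cutex i : exists2 j, (i <= j < i + D)%N & cut j.
  have [k /andP[ik ki]] := near i.
  apply: contrapT => H.
  have nk := ni k k.+1 (ltnSn k).
  have e : (n k + (n k.+1 - n k).-1.+1 = n k.+1)%N by nlia.
  have : forall j, (n k <= j < n k + (n k.+1 - n k).-1.+1)%N -> ~~ cut j.
    move=> j jn; apply/negP => cj; apply: H; exists j => //.
    by have := nB k; rewrite /D; nlia.
  move=> /uncut; rewrite e; apply/negP; rewrite -leNgt.
  have := nq k; rewrite ler_pdivlMr//; apply: le_trans.
  rewrite ler_pM2r//; apply: le_trans qB; apply: ler_weXn2l; first exact: ltW.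
  by have := nB k; nlia.
have D0 : (0 < D)%N by have [j jD _] := cutex 0%N; nlia.
pose blk i := (\sum_(0 <= j < i) cut j)%N.
have blkS i : blk i.+1 = (blk i + cut i)%N by rewrite /blk big_nat_recr.
have blk_homo : {homo blk : i j / (i <= j)%N}.
  by apply: homo_leq => //; [exact: leq_trans|move=> i; rewrite blkS leq_addr].
have blk_le i : (blk i <= i)%N.
  by elim: i => [|i IH]; [rewrite /blk big_geq|rewrite blkS; case: (cut i); nlia].
have growth i m : q ^+ (blk (i + m)%N - blk i) * lam i <= lam (i + m)%N.
  elim: m => [|m IH]; first by rewrite addn0 subnn expr0 mul1r.
  rewrite addnS blkS; have := blk_homo i (i + m)%N (leq_addr _ _) => bb.
  have [c|c] := boolP (cut (i + m)%N).
    rewrite addn1 subSn// exprS -mulrA; apply: le_trans c.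
    by rewrite ler_pM2l.
  by rewrite addn0; apply: le_trans IH _; apply/ltW/lami.
have blkD i : (blk i < blk (i + D))%N.
  have [j jD cj] := cutex i.
  have := blkS j; rewrite cj addn1 => e.
  have [ij jD'] := andP jD.
  by have := blk_homo i j ij; have := blk_homo j.+1 (i + D)%N jD'; nlia.
have ex k : exists i, (k <= blk i)%N.
  elim: k => [|k [i ki]]; first by exists 0%N.
  by exists (i + D)%N; have := blkD i; nlia.
pose st k := ex_minn (ex k).
(* As [blk] rises by at most 1 per index, it equals k at the first index where it reaches k. *)
have stP k : blk (st k) = k /\ (forall i, (k <= blk i)%N -> (st k <= i)%N).
  rewrite /st; case: ex_minnP => m km min; split=> //.
  apply/eqP; rewrite eqn_leq km andbT.
  case: m km min => [|m] km min; first by rewrite /blk big_geq.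
  rewrite blkS leqNgt; apply/negP => H.
  by have := min m; case: (cut m) H => /=; nlia.
have samelen i j : blk i = blk j -> (i < j + D)%N.
  move=> e; rewrite ltnNge; apply/negP => /blk_homo; have := blkD j; nlia.
(* Within a block only the last index can be a cut, so at most D ratios, each below q, separate its
   exponents; hence the range M = q^D. *)
exists blk, st, q, (q ^+ D), D; split => //; first by rewrite exprn_ege1// ltW.
split => //.
- move=> i j ij; have lij : (i <= j)%N.
    by rewrite leqNgt; apply/negP => /ltnW /blk_homo; nlia.
  by have := growth i (j - i)%N; rewrite subnKC.
- by move=> k; case: (stP k).
- move=> i; have [bs smin] := stP (blk i).
  have si := smin i (leqnn _).
  apply/andP; split.
    move: si; rewrite leq_eqVlt => /predU1P[->//|/lami/ltW//].
  have := samelen i (st (blk i)) (esym bs) => iD.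
  have [m em] : exists m, i = (st (blk i) + m)%N by exists (i - st (blk i))%N; nlia.
  case: m em => [|m] em.
    rewrite em addn0 bs; set z := st (blk i).
    by rewrite ler_peMl// ?exprn_ege1// ltW.
  have nc : forall j, (st (blk i) <= j < st (blk i) + m.+1)%N -> ~~ cut j.
    move=> j /andP[j1 j2]; apply/negP => cj.
    have := blkS j; rewrite cj addn1 => e.
    have := blk_homo _ _ j1; have := blk_homo j.+1 i; nlia.
  have := uncut _ _ nc; rewrite -em => /ltW /le_trans; apply.
  by rewrite ler_pM2r// ler_weXn2l//; [exact: ltW|nlia].
- move=> N k; rewrite -(size_iota (st k) D).
  apply: uniq_leq_size; first by rewrite filter_uniq// iota_uniq.
  move=> i; rewrite mem_filter !mem_iota => /andP[/eqP ik _].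
  have [bs smin] := stP k; rewrite smin ?ik//=.
  by apply: samelen; rewrite bs.
Qed.
End Blocks.

(** * Block decomposition *)

Section BlockDecomposition.
Variables (R : realType) (lam : nat -> R) (blk st : nat -> nat) (q M : R).
Variable D : nat.
Hypothesis lam_gt0 : forall n, 0 < lam n.
Hypothesis q_gt1 : 1 < q.
Hypothesis M_ge1 : 1 <= M.
Hypothesis blk_le : forall i, (blk i <= i)%N.
Hypothesis blk_sep : forall i j, (blk i < blk j)%N ->
  q ^+ (blk j - blk i) * lam i <= lam j.
Hypothesis blk_st : forall k, blk (st k) = k.
Hypothesis blk_range : forall i, lam (st (blk i)) <= lam i <= M * lam (st (blk i)).
Hypothesis blk_size : forall N k, (size [seq i <- iota 0 N | blk i == k] <= D)%N.

Let a k := lam (st k).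

Definition terms N (c : nat -> R) := [seq (c i, lam i) | i <- iota 0 N].
Definition block N (c : nat -> R) k :=
  [seq (c i, lam i) | i <- iota 0 N & blk i == k].

Lemma size_block N c k : (size (block N c k) <= D)%N.
Proof. by rewrite size_map. Qed.

Lemma block_range N c k p : p \in block N c k -> a k <= p.2 <= M * a k.
Proof.
by move=> /mapP[i]; rewrite mem_filter => /andP[/eqP <- _] ->; exact: blk_range.
Qed.

Lemma block_sep j k : (j < k)%N -> q ^+ (k - j) * a j <= a k.
Proof. by move=> jk; have := @blk_sep (st j) (st k); rewrite !blk_st; apply. Qed.

(** As [blk i <= i], the blocks numbered below N exhaust the indices below N. *)
Lemma sum_blocks (F : nat -> R) N : \sum_(i <- iota 0 N) F i =
  \sum_(0 <= k < N) \sum_(i <- iota 0 N | blk i == k) F i.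
Proof.
rewrite (exchange_big_dep predT)//= big_seq [RHS]big_seq; apply: eq_bigr => i.
rewrite mem_iota add0n /= => iN.
rewrite (eq_bigl (fun k => k == blk i)); last by move=> k; rewrite eq_sym.
by rewrite big_nat1_eq leq0n (leq_ltn_trans (blk_le i) iN).
Qed.

Lemma expsum_blocks m N c t : expsum (act m (terms N c)) t =
  \sum_(0 <= k < N) expsum (act m (block N c k)) t.
Proof.
rewrite expsum_act big_map sum_blocks; apply: eq_bigr => k _.
by rewrite expsum_act big_map big_filter.
Qed.

(** Each block contributes at most D equal terms, which leaves a geometric tail. The base is left
    free because the square root of q will be used. *)
Lemma high_blocks_sum (rho : R) k N : 1 < rho ->
  \sum_(i <- iota 0 N | (k < blk i)%N) (rho ^+ (blk i - k))^-1 <= D%:R / (rho - 1).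
Proof.
move=> r1; rewrite big_mkcond sum_blocks.
apply: (@le_trans _ _ (\sum_(0 <= j < N | (k < j)%N) D%:R * (rho ^+ (j - k))^-1)).
  rewrite [leRHS]big_mkcond; apply: ler_sum => j _.
  rewrite (eq_bigr (fun=> if (k < j)%N then (rho ^+ (j - k))^-1 else 0)); last first.
    by move=> i /eqP ->.
  case: ifP => kj; last by rewrite big1.
  rewrite -big_filter big_const_seq count_predT iter_addr_0 -[_ *+ _]mulr_natl.
  by rewrite ler_wpM2r ?ler_nat// invr_ge0 exprn_ge0//; lra.
by rewrite -mulr_sumr ler_wpM2l// geometric_tail.
Qed.

Lemma size_near_blocks N k K :
  (size [seq i <- iota 0 N | (blk i < k)%N && (k <= blk i + K)%N] <= K * D)%N.
Proof.
rewrite size_filter; elim: K => [|K IH].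
  by rewrite leqn0 -leqn0 -[X in (_ <= X)%N](count_pred0 (iota 0 N)); apply: sub_count => i /=; lia.
have cD : (count [pred i | blk i == k - K.+1]%N (iota 0 N) <= D)%N.
  by have := blk_size N (k - K.+1)%N; rewrite size_filter.
rewrite mulSn addnC; apply: leq_trans (leq_add IH cD).
rewrite -count_predUI; apply: leq_trans (leq_addr _ _).
by apply: sub_count => i /=; lia.
Qed.

(** Each difference is again a sum over the exponents of block j, so the Bernstein inequality can be
    iterated with b = M a_j. *)
Lemma block_difference CB (N : nat) c j r U d : 0 <= CB -> 0 < d ->
  (forall b h U d, 0 < b -> 0 < d -> (size h <= D)%N ->
    {in h, forall p, 0 <= p.2 <= b} ->
    (forall t, 0 <= t -> `|expsum h t| <= U) ->
    forall t, 0 <= t -> `|expsum h t - expsum h (t + d)| <= CB * (b * d) * U) ->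
  (forall t, 0 <= t -> `|expsum (block N c j) t| <= U) ->
  forall t, 0 <= t ->
    `|expsum (act (fun x => (1 - expR (- (d * x))) ^+ r) (block N c j)) t|
      <= (CB * (M * a j * d)) ^+ r * U.
Proof.
move=> CB0 d0 bern HU; elim: r => [|r IH] t t0.
  by rewrite expr0 mul1r act1 ?HU// => p _; rewrite expr0.
set h := act _ _ in IH.
have hr : {in h, forall p, 0 <= p.2 <= M * a j}.
  move=> p /mapP[p' /block_range /andP[p1 p2] ->]/=.
  by apply/andP; split=> //; apply: le_trans p1; apply/ltW/lam_gt0.
have <- : expsum h t - expsum h (t + d) =
    expsum (act (fun x => (1 - expR (- (d * x))) ^+ r.+1) (block N c j)) t.
  rewrite expsum_shift !expsum_act /h /expsum !big_map -sumrB.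
  by apply: eq_bigr => p _ /=; rewrite exprS; ring.
rewrite exprS -mulrA; apply: bern => //.
- by apply: mulr_gt0; [exact: lt_le_trans M_ge1|exact: lam_gt0].
- by rewrite size_map; exact: size_block.
Qed.

(** The first sum comes from the projector applied to the full exponential sum; the second is what
    the projector leaves of the blocks below k - K, which it does not annihilate. *)
Lemma block_representation : exists2 CB, 0 <= CB & exists2 N2, 1 <= N2 &
  forall r, exists2 N1, 0 <= N1 & forall K, exists2 L, 0 <= L &
  forall N c k (U : nat -> R), (k < N)%N ->
    (forall j t, 0 <= t -> `|expsum (block N c j) t| <= U j) ->
  exists l : seq (R * R), [/\ forall p, p \in l -> (a k)^-1 <= p.2 <= (1 + L) / a k,
    \sum_(p <- l) `|p.1| <= N1 * N2 ^+ K &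
    forall t, 0 <= t -> `|expsum (block N c k) t| <=
      \sum_(p <- l) `|p.1| * `|expsum (terms N c) (t + p.2)| +
      N1 * N2 ^+ K * \sum_(0 <= j < N | (j + K < k)%N) (CB * (M * a j / a k)) ^+ r * U j].
Proof.
have [CB CB0 bern] := @expsum_bernstein R D; exists CB => //.
(* For an exponent in block j > k, the growth q^(j-k) is split in two: the shifts s_i decay like
   rho^(-(j-k)) and are summable, while s_i times the exponent still grows like rho^(j-k), so that
   the x_i are summable too. *)
pose rho := Num.sqrt q.
have q0 : 0 < q by exact: lt_trans ltr01 q_gt1.
have rho1 : 1 < rho by rewrite -sqrtr1 ltr_sqrt.
have rho2 : rho ^+ 2 = q by rewrite sqr_sqrtr// ltW.
pose Z := D%:R / (rho - 1).
have Z0 : 0 <= Z by rewrite divr_ge0//; lra.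
have iq : 0 < 1 - q^-1 by rewrite subr_gt0 invf_lt1.
(* Makes X = 1/(2 Z + 1) below, so that the x_i sum to at most X Z <= 1/2. *)
pose Ls := (2 * Z + 1) / (1 - q^-1).
have Ls0 : 0 < Ls by rewrite divr_gt0//; lra.
have [N2 N21 proj] := @block_projector R D q M (Ls * Z) q_gt1 M_ge1 (mulr_ge0 (ltW Ls0) Z0).
exists N2 => // r; have {proj}[N1 N10 proj] := proj r.
exists (2 ^+ r * N1); first by rewrite mulr_ge0// exprn_ge0.
move=> K; have {proj}[L L0 proj] := proj K.
exists (L + r%:R); first by rewrite addr_ge0.
move=> N c k U kN HU.
have a0 : 0 < a k := lam_gt0 _.
pose X := ((1 - q^-1) * Ls)^-1.
have X0 : 0 <= X by rewrite invr_ge0 mulr_ge0// ltW.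
pose hi := [seq i <- iota 0 N | (k < blk i)%N].
pose s i := Ls / a k * (rho ^+ (blk i - k))^-1.
pose x i := X * (rho ^+ (blk i - k))^-1.
have rn n : 0 < rho ^+ n by rewrite exprn_gt0//; lra.
have exp_le i g : 0 < g -> (1 - q^-1) * (q ^+ (blk i - k) * a k) <= g ->
    expR (- (s i * g)) <= x i.
  move=> g0 hg; have s0 : 0 < s i by apply: mulr_gt0; [exact: divr_gt0|rewrite invr_gt0 rn].
  apply: le_trans (expRN_le _) _; first exact: mulr_gt0.
  have y0 : 0 < (1 - q^-1) * Ls * rho ^+ (blk i - k).
    by apply: mulr_gt0 (rn _); exact: mulr_gt0.
  have sg0 : 0 < s i * g by exact: mulr_gt0.
  rewrite /x /X -invfM lef_pV2 ?posrE//.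
  apply: le_trans (_ : s i * ((1 - q^-1) * (q ^+ (blk i - k) * a k)) <= _); last first.
    by rewrite ler_pM2l.
  rewrite le_eqVlt; apply/orP; left; apply/eqP.
  have -> : q ^+ (blk i - k) = rho ^+ (blk i - k) * rho ^+ (blk i - k).
    by rewrite -rho2 -exprM mulnC exprM expr2.
  rewrite /s; move: (rn (blk i - k)%N) => /lt0r_neq0; set w := rho ^+ _ => w0.
  by field; rewrite w0 !gt_eqF.
have [|||||||G LG HG] := proj _ (a k) [seq p.2 | p <- block N c k]
   [seq lam i | i <- iota 0 N & (blk i < k)%N && (k <= blk i + K)%N] hi s lam x a0.
- by rewrite size_map size_block.
- by move=> _ /mapP[p /block_range + ->].
- by rewrite size_map size_near_blocks.
- move=> _ /mapP[i + ->]; rewrite mem_filter => /andP[/andP[ik _] _]; split.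
    exact: ltW.
  have := @blk_sep i (st k); rewrite blk_st => /(_ ik); apply: le_trans.
  rewrite ler_pM2r// -[leLHS]expr1; apply: ler_weXn2l; first exact: ltW.
  by rewrite subn_gt0.
- move=> i; rewrite mem_filter => /andP[ki _].
  have qi : q ^+ (blk i - k) * a k <= lam i.
    by have := @blk_sep (st k) i; rewrite blk_st; apply.
  have qq : 0 < q ^+ (blk i - k) * a k by rewrite mulr_gt0// exprn_gt0.
  split.
  + by apply: mulr_ge0; [apply: divr_ge0; exact: ltW|rewrite invr_ge0; exact/ltW/rn].
  + by apply: mulr_ge0 => //; rewrite invr_ge0; exact/ltW/rn.
  + apply: exp_le; first exact: lam_gt0.
    apply: le_trans qi; rewrite ler_piMl ?(ltW qq)//.
    have : 0 < q^-1 by rewrite invr_gt0.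
    lra.
  move=> _ /mapP[p pb ->].
  have qp : q * p.2 <= lam i.
    move: pb => /mapP[j]; rewrite mem_filter => /andP[/eqP jk _] -> /=.
    have := @blk_sep j i; rewrite jk => /(_ ki); apply: le_trans.
    rewrite ler_pM2r// -[leLHS]expr1; apply: ler_weXn2l; first exact: ltW.
    by rewrite subn_gt0.
  have {}qp : p.2 <= q^-1 * lam i by rewrite mulrC ler_pdivlMr// mulrC.
  have H : (1 - q^-1) * (q ^+ (blk i - k) * a k) <= (1 - q^-1) * lam i by rewrite ler_pM2l.
  have : 0 < (1 - q^-1) * (q ^+ (blk i - k) * a k) by rewrite mulr_gt0.
  by move=> H'; apply: exp_le; lra.
- rewrite -mulr_sumr big_filter mulrAC ler_pM2r ?invr_gt0// ler_pM2l//.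
  exact: high_blocks_sum.
- rewrite -mulr_sumr big_filter.
  apply: (@le_trans _ _ (X * Z)); first by rewrite ler_wpM2l// high_blocks_sum.
  have -> : X = (2 * Z + 1)^-1 by rewrite /X /Ls mulrC divfK// gt_eqF.
  rewrite mulrC ler_pdivrMr; lra.
have ia0 : 0 <= (a k)^-1 by rewrite invr_ge0 ltW.
pose T y := expR (- ((a k)^-1 * y)).
have LT : laplace 1 (a k)^-1 T by exact: laplace_shift.
rewrite -/T in HG.
set Phi : R -> R := fun y => _ in HG; case: HG => Phi1 Phi0n Phi0h.
have LTG := laplaceM LT LG.
have LdG := laplaceM (@laplace_difference R _ r ia0) LG.
have NK0 : 0 <= N1 * N2 ^+ K by rewrite mulr_ge0// exprn_ge0//; lra.
have [l0 [l01 l02 l03]] := LdG.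
(* The factor T of the projector translates every atom by 1/a_k. *)
exists [seq (p.1, (a k)^-1 + p.2) | p <- l0]; split.
- move=> _ /mapP[p /l01 /andP[p0 p1] ->] /=.
  have -> : (1 + (L + r%:R)) / a k = (a k)^-1 + (r%:R * (a k)^-1 + L / a k) by ring.
  by rewrite lerDl p0 lerD2l.
- by rewrite big_map -mulrA.
move=> t t0.
have PhiE y : Phi y = expsum [seq (p.1, (a k)^-1 + p.2) | p <- l0] y.
  rewrite /Phi -mulrA l03 /expsum big_map mulr_sumr; apply: eq_bigr => p _ /=.
  by rewrite mulrDl opprD expRD mulrCA.
have split_sum : expsum (act Phi (terms N c)) t = expsum (block N c k) t +
    \sum_(0 <= j < N | (j + K < k)%N) expsum (act Phi (block N c j)) t.
  rewrite expsum_blocks (bigD1_seq k) ?mem_index_iota ?iota_uniq//=.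
  congr (_ + _).
    by apply: act1 => p pb; apply: Phi1; apply/mapP; exists p.
  rewrite big_nat_cond [RHS]big_nat_cond big_mkcond [RHS]big_mkcond /=.
  apply: eq_bigr => j _.
  have [jN/=|//] := ltnP j N; rewrite ?andbF//.
  have [jK|jK] := ltnP (j + K)%N k.
    by rewrite (ltn_eqF (leq_ltn_trans (leq_addr K j) jK)).
  case: ifP => // jk; apply: act0 => p /mapP[i]; rewrite mem_filter => /andP[/eqP ij iN] -> /=.
  have [kj|kj] := ltnP k j.
    by apply: Phi0h; rewrite mem_filter ij kj.
  apply: Phi0n; apply/mapP; exists i => //.
  by rewrite mem_filter iN ij jK !andbT ltn_neqAle jk.
have -> : expsum (block N c k) t = expsum (act Phi (terms N c)) t -
    \sum_(0 <= j < N | (j + K < k)%N) expsum (act Phi (block N c j)) t.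
  by rewrite split_sum addrK.
rewrite (le_trans (ler_normB _ _))// lerD//.
  rewrite (@act_eq _ Phi (expsum _) _ _ (fun p _ => PhiE _)) expsum_act_laplace.
  by rewrite (le_trans (ler_norm_sum _ _ _))//; under eq_bigr do rewrite normrM.
rewrite (le_trans (ler_norm_sum _ _ _))// mulr_sumr; apply: ler_sum => j _.
have U0 : 0 <= U j := le_trans (normr_ge0 _) (HU j 0 (lexx 0)).
have aj0 : 0 <= a j by exact/ltW/lam_gt0.
have E0 : 0 <= (CB * (M * a j / a k)) ^+ r * U j.
  apply: mulr_ge0 => //; apply/exprn_ge0/mulr_ge0 => //; apply: mulr_ge0 => //.
  by apply: mulr_ge0 => //; exact: le_trans M_ge1.
apply: (@le_trans _ _ (1 * (N1 * N2 ^+ K) * ((CB * (M * a j / a k)) ^+ r * U j))); last first.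
  by rewrite ler_wpM2r// mul1r -mulrA ler_peMl// exprn_ege1// ler1n.
(* On a surviving block the r-th difference is taken first, to be bounded by Bernstein; T G then
   costs only its norm. *)
have -> : expsum (act Phi (block N c j)) t =
    expsum (act (fun y => T y * G y) (act (fun y => (1 - T y) ^+ r) (block N c j))) t.
  rewrite expsum_act [RHS]expsum_act [X in _ = \sum_(p <- X) _]/act [RHS]big_map.
  by apply: eq_bigr => p _ /=; rewrite /Phi /T; move: (_ ^+ r) => w; ring.
apply: act_bound LTG E0 _ => u /andP[tu _].
have d0 : 0 < (a k)^-1 by rewrite invr_gt0.
apply: (@block_difference CB N c j r (U j) (a k)^-1 CB0 d0 bern (HU j)).
exact: le_trans tu.
Qed.
End BlockDecomposition.

(** * Integral estimates *)

Section PowerSums.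
Variable R : realType.
Import numFieldNormedType.Exports.
Implicit Types (h : seq (R * R)).
Local Notation leb := (@lebesgue_measure R).

Definition powsum h (x : R) : R := \sum_(p <- h) p.1 * x `^ p.2.

Lemma powsumE h x : 0 < x -> powsum h x = expsum h (- ln x).
Proof.
move=> x0; apply: eq_bigr => p _; rewrite /powR gt_eqF//.
by rewrite mulrN opprK.
Qed.

Lemma powsum_expR h t : powsum h (expR (- t)) = expsum h t.
Proof. by rewrite powsumE ?expR_gt0// expRK opprK. Qed.

Lemma powsum0 h : {in h, forall p, 0 < p.2} -> powsum h 0 = 0.
Proof.
move=> h0; rewrite /powsum big_seq big1// => p /h0 p0.
by rewrite powR0 ?mulr0// gt_eqF.
Qed.

Lemma measurable_powsum h (A : set R) : measurable_fun A (powsum h).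
Proof.
rewrite /powsum; apply: measurable_sum => p.
apply: measurable_funM => //; apply: measurable_funTS.
exact: measurable_powR.
Qed.

Lemma continuous_expsum h : continuous (expsum h).
Proof.
move=> t; rewrite /continuous_at /expsum.
elim: h => [|p h IH].
  under eq_fun do rewrite big_nil.
  by rewrite big_nil; exact: cvg_cst.
under eq_fun do rewrite big_cons.
rewrite big_cons; apply: cvgD => //; apply: cvgM; first exact: cvg_cst.
apply: (@continuous_comp _ _ _ (fun t => - (p.2 * t)) expR); last exact: continuous_expR.
by apply: continuousN; apply: mulrl_continuous.
Qed.

(** Substitute x = e^(-(tau + k s)): the Jacobian k x is at least k e^(-(tau + k)) for s in
    [0, 1]. *)
Lemma expsum_integral_le h (tau k : R) : 0 < k ->
  ((k * expR (- (tau + k)))%:E * \int[leb]_(s in `[0%R, 1%R]) `|expsum h (tau + k * s)|%:E <=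
   \int[leb]_(x in `[expR (- (tau + k)), expR (- tau)]) `|powsum h x|%:E)%E.
Proof.
move=> k0; pose F s : R := expR (- (tau + k * s)).
have dF (s : R) : is_derive s (1 : R) F (- k * F s).
  rewrite /F; apply: is_derive_eq.
  by rewrite -[k%:A]/(k * 1); ring.
have F'E : derive1 F = (fun s => - k * F s).
  by apply/funext => s; rewrite derive1E derive_val.
have cF : continuous F.
  by move=> s; apply/differentiable_continuous/derivable1_diffP; case: (dF s).
have cF' : continuous (derive1 F).
  by move=> s; rewrite F'E; apply: cvgM; [exact: cvg_cst|exact: cF].
have F1 : F 1 = expR (- (tau + k)) by rewrite /F mulr1.
have F0 : F 0 = expR (- tau) by rewrite /F mulr0 addr0.
have cexp : continuous (fun s : R => `|expsum h (tau + k * s)|).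
  move=> u; apply: (@continuous_comp _ _ _ (fun s => expsum h (tau + k * s))
    (fun y : R => `|y|)); last exact: norm_continuous.
  apply: (@continuous_comp _ _ _ (fun s => tau + k * s) (expsum h)); last exact: continuous_expsum.
  by apply: cvgD; [exact: cvg_cst|exact: mulrl_continuous].
have -> : (\int[leb]_(x in `[expR (- (tau + k)), expR (- tau)]) `|powsum h x|%:E =
    \int[leb]_(x in `[F 1%R, F 0%R]) `|expsum h (- ln x)|%:E)%E.
  rewrite F0 F1; apply: eq_integral => x; rewrite inE/= in_itv/= => /andP[x1 _].
  by rewrite powsumE// (lt_le_trans _ x1)// expR_gt0.
have subE s : (((fun x : R => `|expsum h (- ln x)|) \o F) * - derive1 F) s =
    `|expsum h (tau + k * s)| * (k * F s).
  rewrite F'E -[LHS]/(`|expsum h (- ln (F s))| * - (- k * F s)).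
  by rewrite expRK opprK mulNr opprK.
rewrite (@integration_by_substitution_decreasing R F (fun x => `|expsum h (- ln x)|) 0 1) //.
- rewrite -ge0_integralZl_EFin//=; first last.
  + by rewrite mulr_ge0 ?expR_ge0 ?ltW.
  + apply/measurable_EFinP; apply: measurable_funTS.
    exact: continuous_measurable_fun.
  apply: ge0_le_integral => //=.
  + by move=> s _; rewrite -EFinM lee_fin; apply: mulr_ge0 => //; apply: mulr_ge0;
      rewrite ?expR_ge0 ?(ltW k0).
  + apply: measurable_funeM; apply/measurable_EFinP; apply: measurable_funTS.
    exact: continuous_measurable_fun.
  + apply: (eq_measurable_fun (fun s => (`|expsum h (tau + k * s)| * (k * F s))%:E)).
      by move=> s _; rewrite subE.
    apply/measurable_EFinP; apply: measurable_funM; apply: measurable_funTS.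
      exact: continuous_measurable_fun.
    by apply: continuous_measurable_fun => s; apply: cvgM; [exact: cvg_cst|exact: cF].
  + move=> s; rewrite ?inE/= ?in_itv/= => /andP[s0 s1].
    rewrite subE -EFinM lee_fin mulrC ler_wpM2l// ler_pM2l// ler_expR lerN2 lerD2l.
    by rewrite -[leRHS]mulr1 ler_pM2l.
- by move=> x y _ _ xy; rewrite /F ltr_expR ltrN2 ltrD2l ltr_pM2l.
- by apply/cvg_ex; exists (derive1 F 0); apply: cvg_at_right_filter; exact: cF'.
- by apply/cvg_ex; exists (derive1 F 1); apply: cvg_at_left_filter; exact: cF'.
- split.
  + by move=> s _; case: (dF s).
  + by apply: cvg_at_right_filter; exact: cF.
  + by apply: cvg_at_left_filter; exact: cF.
- apply: continuous_in_subspaceT => x; rewrite inE/= in_itv/= => /andP[x1 _].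
  have x0 : 0 < x by apply: lt_le_trans x1; exact: expR_gt0.
  apply: (@continuous_comp _ _ _ (fun s => expsum h (- ln s))
    (fun y : R => `|y|)); last exact: norm_continuous.
  apply: (@continuous_comp _ _ _ (fun s : R => - ln s) (expsum h)); last exact: continuous_expsum.
  by apply: continuousN; exact: continuous_ln.
Qed.
End PowerSums.

Section Averages.
Variable R : realType.
Import numFieldNormedType.Exports.
Implicit Types (h : seq (R * R)).
Local Notation leb := (@lebesgue_measure R).

Lemma measurable_abs_powsum h (A : set R) :
  measurable_fun A (fun x => `|powsum h x|%:E).
Proof.
apply/measurable_EFinP; apply: measurableT_comp => //; exact: measurable_powsum.
Qed.

Lemma expsum_average h (tau k lo hi k0 w : R) :
  0 < k0 -> k0 <= k -> lo <= tau -> tau + k <= hi ->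
  (\int[leb]_(x in `[expR (- hi), expR (- lo)]) `|powsum h x|%:E = w%:E)%E ->
  (\int[leb]_(s in `[0%R, 1%R]) `|expsum h (tau + k * s)|%:E <=
   (k0^-1 * expR hi * w)%:E)%E.
Proof.
move=> k00 k0k lot thi wE.
have k_gt0 : 0 < k := lt_le_trans k00 k0k.
have c0 : 0 < k * expR (- (tau + k)) by rewrite mulr_gt0 ?expR_gt0.
have w0 : 0 <= w.
  by rewrite -lee_fin -wE; apply: integral_ge0 => x _; rewrite lee_fin.
have H : (\int[leb]_(x in `[expR (- (tau + k)), expR (- tau)]) `|powsum h x|%:E <= w%:E)%E.
  rewrite -wE; apply: ge0_subset_integral => //.
  - exact: measurable_abs_powsum.
  - apply: subset_itv; rewrite bnd_simp ler_expR lerN2//.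
have := le_trans (expsum_integral_le h tau k_gt0) H.
rewrite -lee_pdivlMl// => /le_trans; apply.
rewrite -EFinM lee_fin ler_wpM2r// invfM -expRN opprK.
by apply: ler_pM; rewrite ?invr_ge0 ?(ltW k_gt0) ?expR_ge0 ?ler_expR// lef_pV2.
Qed.

Lemma measurable_abs_expsum_affine h (tau k : R) (A : set R) :
  measurable_fun A (fun s => `|expsum h (tau + k * s)|).
Proof.
apply: measurable_funTS; apply: measurableT_comp => //.
apply: continuous_measurable_fun => u.
apply: (@continuous_comp _ _ _ (fun s => tau + k * s) (expsum h)).
  by apply: cvgD; [exact: cvg_cst|exact: mulrl_continuous].
exact: continuous_expsum.
Qed.

(** [V] does not depend on s, so integrating the inequality over [0, 1] replaces point values by
    integrals over parts of one common window. *)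
Lemma average_bound h (I : eqType) (r : seq I) (coef tau kap : I -> R)
    (V E lo hi k0 w : R) : 0 < k0 ->
  (forall i, 0 <= coef i) ->
  {in r, forall i, [/\ k0 <= kap i, lo <= tau i & tau i + kap i <= hi]} ->
  (\int[leb]_(x in `[expR (- hi), expR (- lo)]) `|powsum h x|%:E = w%:E)%E ->
  (forall s, 0 <= s <= 1 ->
     V <= \sum_(i <- r) coef i * `|expsum h (tau i + kap i * s)| + E) ->
  V <= (\sum_(i <- r) coef i) * (k0^-1 * expR hi * w) + E.
Proof.
move=> k00 coef0 ir wE HV.
have w0 : 0 <= w.
  by rewrite -lee_fin -wE; apply: integral_ge0 => x _; rewrite lee_fin.
have B0 : 0 <= k0^-1 * expR hi * w.
  by apply: mulr_ge0 => //; apply: mulr_ge0; rewrite ?invr_ge0 ?expR_ge0 ?(ltW k00).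
(* Splitting off this case makes the constant integrand V - E nonnegative. *)
have [VE|EV] := leP V E.
  by apply: (le_trans VE); rewrite lerDr mulr_ge0// sumr_ge0.
have mI (i : I) : measurable_fun (`[0, 1] : set R)
    (fun s => (coef i)%:E * `|expsum h (tau i + kap i * s)|%:E)%E.
  apply: measurable_funeM; apply/measurable_EFinP; exact: measurable_abs_expsum_affine.
have m1 : leb `[0%R, 1%R] = 1%E.
  by rewrite lebesgue_measure_itv/= lte_fin ltr01 sube0.
have : (\int[leb]_(s in `[0%R, 1%R]) (cst (V - E)%:E s) <=
   \int[leb]_(s in `[0%R, 1%R]) \sum_(i <- r) (coef i)%:E * `|expsum h (tau i + kap i * s)|%:E)%E.
  apply: ge0_le_integral => //.
  - by move=> s _; rewrite lee_fin subr_ge0 ltW.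
  - exact: emeasurable_sum.
  - move=> s; rewrite /= in_itv/= => s01.
    by under eq_bigr do rewrite -EFinM; rewrite sumEFin lee_fin lerBlDr HV.
rewrite integral_cst// [X in (_ * X)%E]m1 mule1 ge0_integral_sum//=; last first.
  by move=> i s _; rewrite mule_ge0// lee_fin.
move=> H; rewrite -lerBlDr -lee_fin; apply: (le_trans H).
rewrite mulr_suml -sumEFin big_seq [leRHS]big_seq; apply: lee_sum => i /ir[k1 l1 h1].
rewrite ge0_integralZl_EFin//; last first.
  apply/measurable_EFinP; exact: measurable_abs_expsum_affine.
rewrite EFinM lee_wpmul2l ?lee_fin//.
exact: expsum_average wE.
Qed.

Lemma powsum_abs_le h x : {in h, forall p, 0 < p.2} -> 0 <= x <= 1 ->
  `|powsum h x| <= \sum_(p <- h) `|p.1|.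
Proof.
move=> h0 /andP[x0 x1]; rewrite (le_trans (ler_norm_sum _ _ _))//.
rewrite big_seq [leRHS]big_seq; apply: ler_sum => p /h0 p0.
rewrite normrM (ger0_norm (powR_ge0 _ _)) ler_piMr//.
rewrite /powR; case: eqP => [_|/eqP xn0]; first by rewrite gt_eqF.
rewrite -[leRHS]expR0 ler_expR pmulr_rle0// ln_le0//.
Qed.

Lemma powsum_integral_finite h (A : set R) : {in h, forall p, 0 < p.2} ->
  measurable A -> A `<=` `[0, 1] ->
  exists2 w, 0 <= w & (\int[leb]_(x in A) `|powsum h x|%:E = w%:E)%E.
Proof.
move=> h0 mA A01.
have I0 : (0 <= \int[leb]_(x in A) `|powsum h x|%:E)%E.
  by apply: integral_ge0 => x _; rewrite lee_fin.
have m1 : leb `[0%R, 1%R] = 1%E.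
  by rewrite lebesgue_measure_itv/= lte_fin ltr01 sube0.
have : (\int[leb]_(x in A) `|powsum h x|%:E < +oo)%E.
  apply: (@le_lt_trans _ _ (\int[leb]_(x in `[0%R, 1%R]) (cst (\sum_(p <- h) `|p.1|)%:E x))%E).
    apply: (@le_trans _ _ (\int[leb]_(x in `[0%R, 1%R]) `|powsum h x|%:E)%E).
      by apply: ge0_subset_integral => //; exact: measurable_abs_powsum.
    apply: ge0_le_integral => //; first exact: measurable_abs_powsum.
    by move=> x; rewrite /= in_itv/= => x01; rewrite lee_fin powsum_abs_le.
  by rewrite integral_cst// [X in (_ * X)%E]m1 mule1 ltry.
rewrite -ge0_fin_numE// => /fineK <-.
exists (fine (\int[leb]_(x in A) `|powsum h x|%:E)%E) => //; exact: fine_ge0.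
Qed.

Lemma sum_integral_overlap (d : measure_display) (T : measurableType d)
    (mu : {measure set T -> \bar R}) (D : set T) (W : nat -> set T) (f : T -> R)
    (N P : nat) : measurable D -> (forall k, measurable (W k)) ->
  (forall k, W k `<=` D) -> measurable_fun D f -> (forall x, D x -> 0 <= f x) ->
  (forall x, (\sum_(0 <= k < N) (x \in W k) <= P)%N) ->
  (\sum_(0 <= k < N) \int[mu]_(x in W k) (f x)%:E <=
   P%:R%:E * \int[mu]_(x in D) (f x)%:E)%E.
Proof.
move=> mD mW WD mf f0 HP.
have mf' : measurable_fun D (EFin \o f) by exact/measurable_EFinP.
have WE k : (\int[mu]_(x in W k) (f x)%:E = \int[mu]_(x in D) (((EFin \o f) \_ (W k)) x))%E.
  by rewrite -integral_mkcondr setIidr//; exact: WD.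
under eq_bigr do rewrite WE.
have mfW k : measurable_fun D ((EFin \o f) \_ (W k)).
  apply/(measurable_restrict _ (mW k) mD); apply: measurable_funS mf' => //; exact: subIsetl.
have fW0 k x : D x -> (0 <= ((EFin \o f) \_ (W k)) x)%E.
  by move=> Dx; rewrite patchE; case: ifP => // _; rewrite lee_fin f0.
rewrite -ge0_integral_sum//= -ge0_integralZl_EFin//.
apply: ge0_le_integral => //.
- by move=> x Dx; apply: sume_ge0 => k _; exact: fW0.
- exact: emeasurable_sum.
- exact: measurable_funeM.
- move=> x Dx; rewrite -EFinM.
  rewrite (eq_bigr (fun k => ((x \in W k)%:R * f x)%:E)); last first.
    by move=> k _; rewrite patchE; case: ifP; rewrite ?mul1r ?mul0r.
  rewrite sumEFin lee_fin -mulr_suml ler_wpM2r ?f0//.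
  by rewrite -natr_sum ler_nat.
Qed.

End Averages.

(** * Overlap of the windows, and integrals against a sublinear measure *)

Section Windows.
Variable R : realType.

(** If windows k0 < k share a point then a_k <= L a_k0, which the growth of a by a factor q per step
    excludes once k - k0 >= P. *)
Lemma window_overlap (q L : R) (a : nat -> R) (N P : nat) x :
  1 < q -> (forall k, 0 < a k) ->
  (forall j k, (j < k)%N -> q ^+ (k - j) * a j <= a k) -> L < q ^+ P -> (0 < P)%N ->
  (\sum_(0 <= k < N) (x \in `[expR (- (L / a k)), expR (- (a k)^-1)]%classic) <= P)%N.
Proof.
move=> q1 a0 aq LP P0.
set W := fun k => `[expR (- (L / a k)), expR (- (a k)^-1)]%classic.
rewrite (_ : \sum_(0 <= k < N) _ = size [seq k <- iota 0 N | x \in W k])%N; last first.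
  rewrite size_filter -sum1_count [RHS]big_mkcond /index_iota subn0.
  by apply: eq_bigr => k _; rewrite -/(W k); case: (x \in W k).
have [ex|nex] := pselect (exists k, x \in W k); last first.
  rewrite size_filter (eq_count (a2 := pred0)) ?count_pred0// => k /=.
  by apply/negP => xk; apply: nex; exists k.
case: (ex_minnP ex) => k0 xk0 kmin.
rewrite -(size_iota k0 P); apply: uniq_leq_size; first by rewrite filter_uniq// iota_uniq.
move=> k; rewrite mem_filter !mem_iota => /andP[xk _]; have k0k := kmin k xk; rewrite k0k/=.
rewrite ltnNge; apply/negP => Pk.
have k0ltk : (k0 < k)%N by apply: leq_trans Pk; rewrite -[X in (X < _)%N]addn0 ltn_add2l.
have : a k <= L * a k0.
  move: xk xk0; rewrite !inE /W /= !in_itv/= => /andP[l1 _] /andP[_ l2].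
  have := le_trans l1 l2; rewrite ler_expR lerN2.
  by rewrite ler_pdivlMr// mulrC ler_pdivrMr.
have : q ^+ P * a k0 <= a k.
  apply: le_trans (aq _ _ k0ltk); rewrite ler_pM2r//; apply: ler_weXn2l; first exact: ltW.
  by rewrite leq_subRL// ltnW.
have : L * a k0 < q ^+ P * a k0 by rewrite ltr_pM2r.
lra.
Qed.

(** With t = -ln x, the points with t <= (j + 1) tau have mass at most C (j + 1) tau, and |F| <= U /
    2^j from t = j tau on; the series of (j + 1) / 2^j has sum 4. *)
Lemma sublinear_decay_integral (mu : {finite_measure set (measurableTypeR R) -> \bar R})
    (C U tau : R) (F : R -> R) : 0 <= C -> 0 <= U -> 0 < tau ->
  (forall u, 0 < u -> (mu `[expR (- u), 1%R]%classic <= (C * u)%:E)%E) ->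
  measurable_fun (`[0, 1] : set R) F -> F 0 = 0 ->
  (forall j t, tau *+ j <= t -> `|F (expR (- t))| <= U / 2 ^+ j) ->
  (\int[mu]_(x in `[0%R, 1%R]) `|F x|%:E <= ((4 * C + 1) * tau * U)%:E)%E.
Proof.
move=> C0 U0 tau0 muC mF F0 HF.
have mufin : mu `[0%R, 1%R]%classic \is a fin_num by apply: fin_num_measure.
pose m := fine (mu `[0%R, 1%R]%classic).
have mE : mu `[0%R, 1%R]%classic = m%:E by rewrite fineK.
have m0 : 0 <= m by rewrite fine_ge0.
(* Finitely many layers suffice: beyond them the bound U / 2^J times the total mass is at most U
   tau, whence the 1 in 4 C + 1. *)
pose J := (Num.truncn (m / tau)).+1.
have mJ : m <= tau * 2 ^+ J.
  rewrite -ler_pdivrMl// mulrC ltW// (lt_le_trans (truncnS_gt _))//.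
  by rewrite -natrX ler_nat ltnW// ltn_expl.
pose A j : set R := `[expR (- (tau *+ j.+1)), 1%R]%classic.
have mA j : measurable (A j) by exact: measurable_itv.
pose b j : R := U / 2 ^+ j.
have b0 j : 0 <= b j by rewrite divr_ge0// exprn_ge0.
have A01 j : A j `<=` `[0%R, 1%R].
  by apply: subset_itvr; rewrite bnd_simp expR_ge0.
have bound x : `[0%R, 1%R]%classic x ->
    `|F x| <= \sum_(0 <= j < J) b j * \1_(A j) x + b J.
  rewrite /= in_itv/= => /andP[x0 x1].
  have S0 : 0 <= \sum_(0 <= j < J) b j * \1_(A j) x.
    by apply: sumr_ge0 => j _; rewrite mulr_ge0// indicE.
  (* The point 0 is not of the form e^(-t); there F vanishes. *)
  move: x0; rewrite le_eqVlt => /predU1P[<-|x0].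
    by rewrite F0 normr0 addr_ge0// sumr_ge0// => j _; rewrite mulr_ge0// indicE.
  pose t := - ln x.
  have xE : x = expR (- t) by rewrite opprK lnK// posrE.
  have t0 : 0 <= t by rewrite oppr_ge0 ln_le0.
  have /andP[j1 j2] := truncn_itv (divr_ge0 t0 (ltW tau0)).
  set j := Num.truncn (t / tau) in j1 j2.
  rewrite ler_pdivlMr// mulr_natl in j1.
  rewrite ltr_pdivrMr// mulr_natl in j2.
  have [jJ|Jj] := ltnP j J.
    have xA : x \in A j.
      by rewrite inE /A /= in_itv/= x1 xE ler_expR lerN2 ltW.
    rewrite (bigD1_seq j) ?mem_index_iota ?iota_uniq//= indicE xA mulr1.
    apply: (le_trans (_ : _ <= b j)); first by rewrite xE; exact: HF.
    rewrite -addrA lerDl addr_ge0// sumr_ge0// => i _; by rewrite mulr_ge0// indicE.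
  apply: (le_trans (_ : _ <= b J)); last by rewrite lerDr.
  by rewrite xE; apply: HF; apply: le_trans j1; rewrite ler_wpMn2l// ltW.
apply: (@le_trans _ _ (\int[mu]_(x in `[0%R, 1%R])
   ((\sum_(0 <= j < J) (b j)%:E * (\1_(A j) x)%:E) + (b J)%:E))%E).
  apply: ge0_le_integral => //.
  - by apply/measurable_EFinP; exact: measurableT_comp.
  - apply: emeasurable_funD => //; apply: emeasurable_sum => j.
    by apply: measurable_funeM; apply/measurable_EFinP; exact: (measurable_indic (mA _)).
  - move=> x x01; under eq_bigr do rewrite -EFinM.
    by rewrite sumEFin -EFinD lee_fin bound.
have mind j : measurable_fun (`[0%R, 1%R] : set (measurableTypeR R))
    (fun x => (b j)%:E * (\1_(A j) x)%:E)%E.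
  by apply: measurable_funeM; apply/measurable_EFinP; exact: (measurable_indic (mA _)).
rewrite ge0_integralD//; first last.
- by move=> x _; rewrite lee_fin.
- exact: emeasurable_sum.
- by move=> x _; apply: sume_ge0 => j _; rewrite mule_ge0// lee_fin// indicE.
rewrite ge0_integral_sum//; last first.
  by move=> j x _; rewrite mule_ge0// lee_fin// indicE.
rewrite integral_cst// [X in (_ * X)%E]mE.
apply: (@le_trans _ _ ((\sum_(0 <= j < J) (b j * (C * (tau *+ j.+1)))%:E) + (b J * m)%:E)%E).
  rewrite EFinM leeD2r//; apply: lee_sum => j _.
  rewrite ge0_integralZl_EFin//; last by apply/measurable_EFinP; exact: (measurable_indic (mA _)).
  rewrite integral_indic; [|by []|exact: mA]. rewrite (setIidl (@A01 j)).
  rewrite [leRHS]EFinM; apply: lee_wpmul2l; first by rewrite lee_fin.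
  by apply: muC; rewrite pmulrn_lgt0.
rewrite sumEFin -EFinD lee_fin.
have S4 n : \sum_(0 <= j < n) j.+1%:R / 2 ^+ j = 4 - (2 * n + 4)%:R / 2 ^+ n :> R.
  elim: n => [|n IH]; first by rewrite big_geq// expr0 divr1 muln0 add0n subrr.
  rewrite big_nat_recr//= IH exprS !natrD !natrM -!natr1.
  by field; rewrite expf_neq0.
have -> : \sum_(0 <= j < J) b j * (C * (tau *+ j.+1)) =
    U * C * tau * \sum_(0 <= j < J) j.+1%:R / 2 ^+ j.
  rewrite mulr_sumr; apply: eq_bigr => j _; rewrite /b -[tau *+ _]mulr_natr.
  by rewrite -!mulrA; congr (_ * _); ring.
have : U * C * tau * \sum_(0 <= j < J) j.+1%:R / 2 ^+ j <= U * C * tau * 4.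
  rewrite ler_wpM2l ?mulr_ge0 ?(ltW tau0)// S4 gerBl divr_ge0// exprn_ge0//.
have : b J * m <= U * tau.
  rewrite /b -mulrA ler_wpM2l// mulrC ler_pdivrMr ?exprn_gt0//.
lra.
Qed.
End Windows.

(** * Absorption, and the inequality for real coefficients *)

Section Assembly.
Variable R : realType.
Local Notation leb := (@lebesgue_measure R).

Lemma expr_unbounded (q B : R) : 1 < q -> exists n, B <= q ^+ n.
Proof.
move=> q1; have bern n : 1 + (q - 1) * n%:R <= q ^+ n.
  elim: n => [|n IH]; first by rewrite mulr0 addr0 expr0.
  have : 0 <= (q - 1) * ((q - 1) * n%:R) by rewrite !mulr_ge0//; lra.
  have : q * (1 + (q - 1) * n%:R) <= q * q ^+ n by rewrite ler_pM2l//; lra.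
  rewrite exprS -natr1; lra.
exists (Num.truncn (B / (q - 1))).+1; apply: le_trans (bern _).
have := truncnS_gt (B / (q - 1)).
rewrite ltr_pdivrMr ?subr_gt0// mulrC; lra.
Qed.

(* Each bound involves only blocks at distance more than K below, with
   geometrically small weights, so these terms are absorbed. *)
Lemma block_absorption (q CB M B C1 : R) (K N r : nat) (a U w : nat -> R) :
  1 < q -> (forall k, 0 < a k) ->
  (forall j k, (j < k)%N -> q ^+ (k - j) * a j <= a k) ->
  0 <= CB -> 0 <= M -> 0 <= B -> (forall k, 0 <= U k) ->
  (forall k, (k < N)%N -> U k <= C1 * a k * w k +
     B * \sum_(0 <= j < N | (j + K < k)%N) (CB * (M * a j / a k)) ^+ r * U j) ->
  B * (CB * M) ^+ r * (q ^+ r)^-1 ^+ K / (q - 1) <= 2^-1 ->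
  \sum_(0 <= k < N) U k / a k <= 2 * C1 * \sum_(0 <= k < N) w k.
Proof.
move=> q1 a0 aq CB0 M0 B0 U0 HU small.
have q0 : 0 < q by lra.
pose v k := U k / a k.
have v0 k : 0 <= v k by rewrite divr_ge0// ltW.
set G := (CB * M) ^+ r * (q ^+ r)^-1 ^+ K.
have G0 : 0 <= G.
  rewrite /G; apply: mulr_ge0; apply: exprn_ge0; first exact: mulr_ge0.
  by rewrite invr_ge0 exprn_ge0// ltW.
(* Of the r + 1 factors a_j / a_k, r are bounded by q^(-K) and give the small constant; the last one
   keeps q^(-(k-j)) for the summation over k. *)
have weight j k : (j + K < k)%N ->
    (CB * (M * a j / a k)) ^+ r * U j / a k <= G * ((q ^+ (k - j))^-1 * v j).
  move=> jk; have jk' : (j < k)%N := leq_ltn_trans (leq_addr K j) jk.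
  set y := a j / a k.
  have y0 : 0 <= y by rewrite divr_ge0 ?ltW.
  have qp n : 0 < q ^+ n by exact: exprn_gt0.
  have yq : y <= (q ^+ (k - j))^-1.
    by rewrite /y ler_pdivrMr// mulrC ler_pdivlMr// mulrC aq.
  have yK : y <= (q ^+ K)^-1.
    apply: (le_trans yq); rewrite lef_pV2 ?posrE//; apply: ler_weXn2l; first exact: ltW.
    by rewrite leq_subRL ltnW.
  have -> : (CB * (M * a j / a k)) ^+ r * U j / a k = (CB * M) ^+ r * (y ^+ r * (y * v j)).
    rewrite (_ : CB * _ = (CB * M) * y); last by rewrite /y; ring.
    rewrite exprMn /v /y; move: (_ ^+ r) ((_ / _) ^+ r) => z1 z2.
    by field; rewrite !gt_eqF.
  rewrite /G -mulrA; apply: ler_wpM2l; first exact/exprn_ge0/mulr_ge0.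
  apply: ler_pM; [exact: exprn_ge0|exact: mulr_ge0| |exact: ler_wpM2r].
  rewrite -exprVn -exprM mulnC exprM; apply: lerXn2r; rewrite ?exprVn ?nnegrE//.
  by rewrite invr_ge0 ltW.
have main : \sum_(0 <= k < N) v k <= C1 * \sum_(0 <= k < N) w k +
    B * (G * ((q - 1)^-1 * \sum_(0 <= k < N) v k)).
  apply: (@le_trans _ _ (\sum_(0 <= k < N) (C1 * w k +
     B * \sum_(0 <= j < N | (j + K < k)%N) G * ((q ^+ (k - j))^-1 * v j)))).
    apply: ler_sum_nat => k /andP[_ kN]; rewrite /v ler_pdivrMr//.
    apply: (le_trans (HU k kN)); rewrite mulrDl lerD//.
      by rewrite mulrAC.
    rewrite -mulrA ler_wpM2l// mulr_suml; apply: ler_sum => j jk.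
    by rewrite -ler_pdivrMr// weight.
  rewrite big_split/= -!mulr_sumr lerD2l ler_wpM2l//.
  rewrite (eq_bigr (fun k => G * \sum_(0 <= j < N | (j + K < k)%N)
    (q ^+ (k - j))^-1 * v j)); last by move=> k _; rewrite mulr_sumr.
  rewrite -mulr_sumr ler_wpM2l//.
  apply: (@le_trans _ _ (\sum_(0 <= k < N) \sum_(0 <= j < N | (j < k)%N) (q ^+ (k - j))^-1 * v j)).
    apply: ler_sum => k _; rewrite big_mkcond [leRHS]big_mkcond; apply: ler_sum => j _.
    have t0 : 0 <= (q ^+ (k - j))^-1 * v j by rewrite mulr_ge0// invr_ge0 exprn_ge0// ltW.
    have [jK|jK] := ltnP (j + K)%N k; last by case: ifP.
    by rewrite (leq_ltn_trans (leq_addr K j) jK).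
  rewrite (exchange_big_dep predT)//= mulr_sumr; apply: ler_sum => j _.
  by rewrite -mulr_suml ler_wpM2r// geometric_tail.
rewrite -mulrA.
have v_ge0 : 0 <= \sum_(0 <= k < N) v k by apply: sumr_ge0.
have : B * (G * ((q - 1)^-1 * \sum_(0 <= k < N) v k)) <= 2^-1 * \sum_(0 <= k < N) v k.
  rewrite !mulrA ler_wpM2r//; move: small; rewrite /G !mulrA; lra.
move=> H; rewrite -[leLHS]/(\sum_(0 <= k < N) v k); move: H main.
by set S := \sum_(0 <= k < N) v k; set W := C1 * _; lra.
Qed.

Lemma powsum_blocks (lam : nat -> R) (blk : nat -> nat) N c x :
  (forall i, (blk i <= i)%N) ->
  powsum (terms lam N c) x = \sum_(0 <= k < N) powsum (block lam blk N c k) x.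
Proof.
move=> blk_le; rewrite /powsum big_map (sum_blocks blk_le); apply: eq_bigr => k _.
by rewrite big_map big_filter.
Qed.

Lemma expsum_le_mass (h : seq (R * R)) t : {in h, forall p, 0 < p.2} -> 0 <= t ->
  `|expsum h t| <= \sum_(p <- h) `|p.1|.
Proof.
move=> h0 t0; rewrite (le_trans (ler_norm_sum _ _ _))// big_seq [leRHS]big_seq.
apply: ler_sum => p /h0 p0; rewrite normrM (ger0_norm (expR_ge0 _)) ler_piMr//.
by rewrite -[leRHS]expR0 ler_expR oppr_le0 mulr_ge0// ltW.
Qed.

Lemma real_embedding (lam : nat -> R) (Cmu : R)
    (mu : {finite_measure set (measurableTypeR R) -> \bar R}) :
  (forall n, 0 < lam n) -> {homo lam : m n / (m < n)%N >-> m < n} ->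
  quasilacunary lam -> 0 <= Cmu ->
  (forall u, 0 < u -> (mu `[expR (- u), 1%R]%classic <= (Cmu * u)%:E)%E) ->
  exists2 C : R, 0 <= C & forall N c,
    (\int[mu]_(x in `[0%R, 1%R]) `|powsum (terms lam N c) x|%:E <=
     C%:E * \int[leb]_(x in `[0%R, 1%R]) `|powsum (terms lam N c) x|%:E)%E.
Proof.
move=> lam0 lami lamq Cmu0 muC.
have [blk [st [q [M [D [q1 M1 D0 [blk_le blk_sep blk_st blk_range blk_size]]]]]]] :=
  quasilacunary_blocks lam0 lami lamq.
pose a k := lam (st k).
have a0 k : 0 < a k := lam0 _.
have q0 : 0 < q := lt_trans ltr01 q1.
have M0 : 0 < M := lt_le_trans ltr01 M1.
have aq j k : (j < k)%N -> q ^+ (k - j) * a j <= a k.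
  by move=> jk; exact: (block_sep blk_sep blk_st jk).
have alam k : lam 0 <= a k.
  by rewrite /a; case: (st k) => // n; exact/ltW/lami.
have [CB CB0 [N2 N21 rep]] :=
  block_representation lam0 q1 M1 blk_le blk_sep blk_st blk_range blk_size.
have [r Hr] := expr_unbounded (2 * N2) q1.
have {rep}[N1 N10 rep] := rep r.
have N20 : 0 < N2 := lt_le_trans ltr01 N21.
(* The loss in [expsum_nikolskii]: its factor 4^D and D sampling points. *)
set cD : R := 4 ^+ D * D%:R.
have cD0 : 0 <= cD by rewrite mulr_ge0// exprn_ge0.
(* Given N2 / q^r <= 1/2, this makes the constant in front of the absorbed sum at most 1/2. *)
have [K HK] := expr_unbounded (2 * (cD * N1 * (CB * M) ^+ r / (q - 1))) (ltr1n R 2).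
have {rep}[L L0 rep] := rep K.
set NK := N1 * N2 ^+ K in rep.
have NK0 : 0 <= NK by rewrite mulr_ge0// exprn_ge0// ltW.
set tau : R := (4 * D ^ 2)%:R.
have tau0 : 0 < tau by rewrite ltr0n muln_gt0 expn_gt0 D0.
(* In units of 1/a_k: tau for the range of t, 1 + L for the atoms of the representation, D for the
   sampling points. *)
set Lam := tau + 1 + L + D%:R.
have [P0 HP0] := expr_unbounded (Lam + 1) q1.
have [P P_gt0 HP] : exists2 P, (0 < P)%N & Lam < q ^+ P.
  exists P0.+1 => //; rewrite exprS; apply: (@lt_le_trans _ _ (q ^+ P0)); first lra.
  by rewrite ler_peMl ?exprn_ge0 ?ltW.
(* The factor 2 M comes from the least dilation 1/(2 M a_k); the exponential bounds e^(Lam / a_k)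
   uniformly in k, since a_k >= [lam 0]. *)
set C1 := cD * NK * (2 * M * expR (Lam / lam 0)).
have C10 : 0 <= C1.
  apply: mulr_ge0; first exact: mulr_ge0.
  by apply: mulr_ge0; [rewrite mulr_ge0 ?(ltW M0)|exact: expR_ge0].
set Cm := (4 * Cmu + 1) * tau.
have Cm0 : 0 <= Cm by rewrite mulr_ge0 ?(ltW tau0)//; lra.
exists (Cm * (2 * C1) * P%:R) => [|N c].
  by apply: mulr_ge0 => //; apply: mulr_ge0 => //; exact: mulr_ge0.
set h := terms lam N c.
pose b k := block lam blk N c k.
have b_pos k : {in b k, forall p, 0 < p.2}.
  by move=> p /mapP[i _ ->] /=; exact: lam0.
have h_pos : {in h, forall p, 0 < p.2} by move=> p /mapP[i _ ->] /=; exact: lam0.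
pose U k := sup [set y | exists2 t, 0 <= t & y = `|expsum (b k) t|].
have hasU k : has_sup [set y | exists2 t, 0 <= t & y = `|expsum (b k) t|].
  split; first by exists `|expsum (b k) 0|; exists 0.
  by exists (\sum_(p <- b k) `|p.1|) => _ [t t0 ->]; exact: expsum_le_mass.
have HU k t : 0 <= t -> `|expsum (b k) t| <= U k.
  by move=> t0; apply: sup_upper_bound => //; exists t.
have U0 k : 0 <= U k := le_trans (normr_ge0 _) (HU k 0 (lexx 0)).
pose W k : set R := `[expR (- (Lam / a k)), expR (- (a k)^-1)]%classic.
have W01 k : W k `<=` `[0%R, 1%R].
  apply: subset_itv; rewrite bnd_simp ?expR_ge0//.
  by rewrite -[leRHS]expR0 ler_expR oppr_le0 invr_ge0 ltW.
pose w k := fine (\int[leb]_(x in W k) `|powsum h x|%:E)%E.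
have wE k : (\int[leb]_(x in W k) `|powsum h x|%:E = (w k)%:E)%E.
  rewrite /w; have [y _ ->//] := powsum_integral_finite h_pos (measurable_itv _) (@W01 k).
have w0 k : 0 <= w k.
  by rewrite -lee_fin -wE; apply: integral_ge0 => x _; rewrite lee_fin.
have key k : (k < N)%N -> U k <= C1 * a k * w k +
     cD * NK * \sum_(0 <= j < N | (j + K < k)%N) (CB * (M * a j / a k)) ^+ r * U j.
  move=> kN; set E := \sum_(0 <= j < N | _) _.
  have [l [l1 l2 l3]] := rep N c k U kN HU.
  have Dk0 : 0 < 2 * M * a k by rewrite !mulr_gt0.
  have E0 : 0 <= E.
    apply: sumr_ge0 => j _; apply: mulr_ge0 => //; apply/exprn_ge0/mulr_ge0 => //.
    by rewrite divr_ge0 ?mulr_ge0 ?ltW.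
  (* By [expsum_decay] with j = 0, a bound on [0, tau / a_k] holds for all t >= 0. *)
  suff loc t : 0 <= t <= tau / a k ->
      `|expsum (b k) t| <= C1 * a k * w k + cD * NK * E.
    have := @expsum_decay R D (b k) (a k) _ D0 (a0 k) _ _ loc 0.
    rewrite expr0 divr1 mulr0n => dec.
    apply: ge_sup; first by exists `|expsum (b k) 0|; exists 0.
    move=> _ [t t0 ->]; apply: dec => //; first exact: size_block.
    by move=> p /(block_range blk_range) /andP[].
  move=> /andP[t0 tt].
  (* One term per sampling index j and atom p: the full sum is evaluated at t + p.2 + j s / (2 M
     a_k). *)
  pose I : seq (nat * (R * R)) := [seq (j, p) | j <- iota 1 D, p <- l].
  have rat j : j%:R / (2 * M * a k) <= j%:R / a k.
    rewrite ler_wpM2l// lef_pV2 ?posrE// ler_peMl ?(ltW (a0 k))//; lra.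
  have := @average_bound R h _ I (fun i => 4 ^+ D * `|i.2.1|) (fun i => t + i.2.2)
    (fun i => i.1%:R / (2 * M * a k)) `|expsum (b k) t| (cD * NK * E)
    (a k)^-1 (Lam / a k) (2 * M * a k)^-1 (w k).
  rewrite invr_gt0 => /(_ Dk0) H; apply: le_trans (H _ _ (wE k) _) _ => {H}.
  - by move=> i; rewrite mulr_ge0// exprn_ge0.
  - move=> i /allpairsP[[j p]/= [jD pl ->]]/=.
    move: jD; rewrite mem_iota add1n ltnS => /andP[j1 jD].
    have /andP[p1 p2] := l1 p pl; split.
    + by rewrite ler_peMl ?invr_ge0 ?(ltW Dk0)// ler1n.
    + by rewrite (le_trans p1)// lerDr.
    + have : j%:R / a k <= D%:R / a k by rewrite ler_pM2r ?invr_gt0// ler_nat.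
      have -> : Lam / a k = tau / a k + (1 + L) / a k + D%:R / a k.
        by rewrite /Lam; ring.
      by have := rat j; rewrite -/(a k) in p2; lra.
  - move=> s /andP[s0 s1].
    (* With this step, sg M a_k = s / 2 <= 1/2 for every s in [0, 1], as [expsum_nikolskii]
       requires. *)
    set sg := s / (2 * M * a k).
    have sg0 : 0 <= sg by apply: divr_ge0 => //; exact: ltW.
    have sgb : sg * (M * a k) <= 2^-1.
      rewrite (_ : sg * _ = s / 2); first lra.
      by rewrite /sg; field; rewrite !gt_eqF.
    have bb : {in b k, forall p, p.2 <= M * a k}.
      by move=> p /(block_range blk_range) /andP[].
    have := expsum_nikolskii t sg0 sgb bb; move=> /le_trans; apply.
    have sb : (size (b k) <= D)%N by exact: size_block.
    apply: (@le_trans _ _ (4 ^+ D * \sum_(j <- iota 1 D) `|expsum (b k) (t + sg *+ j)|)).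
      apply: ler_pM; rewrite ?exprn_ge0 ?sumr_ge0//.
        by apply: ler_weXn2l => //; rewrite ler1n.
      rewrite /index_iota subSS subn0 -(subnKC sb) iotaD big_cat/= lerDl.
      exact: sumr_ge0.
    apply: (@le_trans _ _ (4 ^+ D * \sum_(j <- iota 1 D)
        (\sum_(p <- l) `|p.1| * `|expsum h (t + sg *+ j + p.2)| + NK * E))).
      rewrite ler_wpM2l ?exprn_ge0//; apply: ler_sum => j _; apply: l3.
      by rewrite addr_ge0// mulrn_wge0.
    rewrite big_split/= mulrDr lerD//.
      rewrite /I big_allpairs_dep/= mulr_sumr; apply: ler_sum => j _.
      rewrite mulr_sumr; apply: ler_sum => p _; rewrite mulrA ler_wpM2l//.
      rewrite le_eqVlt; apply/orP; left; apply/eqP; congr (`|expsum h _|).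
      by rewrite /sg -[_ *+ j]mulr_natr; ring.
    by rewrite big_const_seq count_predT size_iota iter_addr_0 -[_ *+ D]mulr_natl !mulrA.
  rewrite lerD2r /I big_allpairs_dep/=.
  under eq_bigr do rewrite -mulr_sumr.
  rewrite big_const_seq count_predT size_iota iter_addr_0 -[_ *+ D]mulr_natl.
  have e1 : expR (Lam / a k) <= expR (Lam / lam 0).
    rewrite ler_expR ler_wpM2l ?lef_pV2 ?posrE//.
    by rewrite /Lam !addr_ge0// ltW.
  have S0 : 0 <= \sum_(p <- l) `|p.1| by exact: sumr_ge0.
  rewrite invrK.
  apply: (@le_trans _ _ (D%:R * (4 ^+ D * NK) * (2 * M * a k * expR (Lam / lam 0) * w k))).
    apply: ler_pM.
    + by rewrite !mulr_ge0 ?exprn_ge0.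
    + by rewrite !mulr_ge0 ?expR_ge0 ?(ltW M0) ?(ltW (a0 k)).
    + by rewrite ler_wpM2l// ler_wpM2l// exprn_ge0.
    + by rewrite ler_wpM2r// ler_wpM2l// ltW.
  rewrite le_eqVlt; apply/orP; left; apply/eqP; rewrite /C1 /cD; move: (4 ^+ D) => z; ring.
have absorbed : \sum_(0 <= k < N) U k / a k <= 2 * C1 * \sum_(0 <= k < N) w k.
  apply: (block_absorption q1 a0 aq CB0 (ltW M0) _ U0 key); first exact: mulr_ge0.
  have G0 : 0 <= cD * N1 * (CB * M) ^+ r / (q - 1).
    apply: divr_ge0; last lra.
    by apply: mulr_ge0; [exact: mulr_ge0|apply/exprn_ge0/mulr_ge0 => //; exact: ltW].
  have -> : cD * NK * (CB * M) ^+ r * (q ^+ r)^-1 ^+ K / (q - 1) =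
      cD * N1 * (CB * M) ^+ r / (q - 1) * (N2 / q ^+ r) ^+ K.
    by rewrite /NK [(N2 / _) ^+ K]exprMn; move: (_ ^+ K) (_ ^+ K) (_ ^+ r) => z1 z2 z3; ring.
  apply: (@le_trans _ _ (cD * N1 * (CB * M) ^+ r / (q - 1) * (2^-1) ^+ K)).
    rewrite ler_wpM2l//; apply: lerXn2r; rewrite ?nnegrE.
    - by rewrite divr_ge0 ?exprn_ge0 ?ltW.
    - by rewrite invr_ge0.
    - rewrite ler_pdivrMr ?exprn_gt0//; lra.
  rewrite exprVn ler_pdivrMr ?exprn_gt0//; lra.
apply: (@le_trans _ _ (\sum_(0 <= k < N) \int[mu]_(x in `[0%R, 1%R]) `|powsum (b k) x|%:E)%E).
  rewrite -ge0_integral_sum//; last by move=> k; exact: measurable_abs_powsum.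
  apply: ge0_le_integral => //; first exact: measurable_abs_powsum.
    by apply: emeasurable_sum => k; exact: measurable_abs_powsum.
  by move=> x _; rewrite sumEFin lee_fin (@powsum_blocks lam blk N c x blk_le) ler_norm_sum.
apply: (@le_trans _ _ (\sum_(0 <= k < N) (Cm * (U k / a k))%:E)%E).
  apply: lee_sum => k _.
  have ta : 0 < tau / a k by rewrite divr_gt0.
  have -> : Cm * (U k / a k) = (4 * Cmu + 1) * (tau / a k) * U k by rewrite /Cm; ring.
  apply: sublinear_decay_integral => //.
  - exact: measurable_powsum.
  - exact: powsum0.
  move=> j t jt; rewrite powsum_expR.
  apply: (@expsum_decay R D (b k) (a k) (U k) D0 (a0 k)) jt.
  - exact: size_block.
  - by move=> p /(block_range blk_range) /andP[].
  - by move=> u /andP[u0 _]; exact: HU.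
rewrite sumEFin -mulr_sumr.
apply: (@le_trans _ _ (Cm * (2 * C1) * \sum_(0 <= k < N) w k)%:E).
  by rewrite lee_fin -mulrA ler_wpM2l.
rewrite EFinM [X in (_ <= X * _)%E]EFinM -muleA lee_wpmul2l ?lee_fin//.
  by apply: mulr_ge0 => //; exact: mulr_ge0.
rewrite -sumEFin; under eq_bigr do rewrite -wE.
apply: (@sum_integral_overlap R _ _ leb `[0%R, 1%R]%classic W (fun x => `|powsum h x|)) => //.
- by move=> k; exact: measurable_itv.
- by apply: measurableT_comp => //; exact: measurable_powsum.
- by move=> x; exact: (window_overlap N x q1 a0 aq HP P_gt0).
Qed.
End Assembly.

From mathcomp Require Import complex.

(** * From real to complex coefficients *)

Section ComplexCoefficients.
Variable R : realType.
Implicit Types z : R[i].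

Definition nat_coef N (c : 'I_N -> R) (i : nat) : R := oapp c 0 (insub i).

Lemma powsum_ord (lam : nat -> R) N (c : 'I_N -> R) x :
  powsum (terms lam N (nat_coef c)) x = \sum_(i < N) c i * x `^ lam i.
Proof.
rewrite /powsum big_map -[iota 0 N]/(iota 0 (0 + N)%N) -{1}(subn0 N) -/(index_iota 0 N).
by rewrite big_mkord; apply: eq_bigr => i _; rewrite /nat_coef valK.
Qed.

Lemma Re_muntz_poly (lam : nat -> R) N (c : 'I_N -> R[i]) x :
  complex.Re (muntz_poly lam c x) =
  powsum (terms lam N (nat_coef (fun i => complex.Re (c i)))) x.
Proof.
rewrite powsum_ord /muntz_poly.
rewrite (big_morph (@complex.Re R) (id1 := 0) (op1 := +%R)) //; last by case=> ? ? [].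
by apply: eq_bigr => i _; case: (c i) => u v /=; rewrite mulr0 subr0.
Qed.

Lemma Im_muntz_poly (lam : nat -> R) N (c : 'I_N -> R[i]) x :
  complex.Im (muntz_poly lam c x) =
  powsum (terms lam N (nat_coef (fun i => complex.Im (c i)))) x.
Proof.
rewrite powsum_ord /muntz_poly.
rewrite (big_morph (@complex.Im R) (id1 := 0) (op1 := +%R)) //; last by case=> ? ? [].
by apply: eq_bigr => i _; case: (c i) => u v /=; rewrite mulr0 add0r.
Qed.

Lemma normcE z : Normc.normc z = Num.sqrt (complex.Re z ^+ 2 + complex.Im z ^+ 2).
Proof. by case: z. Qed.

Lemma Re_le_normc z : `|complex.Re z| <= Normc.normc z.
Proof. by rewrite normcE -sqrtr_sqr ler_wsqrtr// lerDl sqr_ge0. Qed.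

Lemma Im_le_normc z : `|complex.Im z| <= Normc.normc z.
Proof. by rewrite normcE -sqrtr_sqr ler_wsqrtr// lerDr sqr_ge0. Qed.

Lemma normc_le_ReIm z : Normc.normc z <= `|complex.Re z| + `|complex.Im z|.
Proof.
rewrite normcE -[leRHS]ger0_norm ?addr_ge0// -sqrtr_sqr ler_wsqrtr//.
by rewrite sqrrD !real_normK ?num_real// lerD2r lerDl mulrn_wge0// mulr_ge0.
Qed.

Lemma measurable_normc_muntz (lam : nat -> R) N (c : 'I_N -> R[i]) (A : set R) :
  measurable_fun A (fun x => (Normc.normc (muntz_poly lam c x))%:E).
Proof.
apply/measurable_EFinP.
under eq_fun do rewrite normcE Re_muntz_poly Im_muntz_poly.
apply: (measurableT_comp (f := @Num.sqrt R)).
  by apply: continuous_measurable_fun; exact: sqrt_continuous.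
by apply: measurable_funD; apply: measurable_funX; exact: measurable_powsum.
Qed.

End ComplexCoefficients.

Theorem theorem5p5 (R : realType) (lam : nat -> R)
  (lam_gt0 : forall n, 0 < lam n)
  (lam_incr : {homo lam : m n / (m < n)%N >-> m < n})
  (lam_summable : (\sum_(0 <= n <oo) ((lam n)^-1)%:E < +oo)%E)
  (lam_quasilac : quasilacunary lam)
  (mu : {finite_measure set (measurableTypeR R) -> \bar R})
  (mu01 : on_unit_interval mu)
  (mu_sublin : sublinear mu) :
  embedding lam mu.
Proof.
have [Cmu Cmu0 HC] := mu_sublin.
have muC u : 0 < u -> (mu `[expR (- u), 1%R]%classic <= (Cmu * u)%:E)%E.
  move=> u0; have e1 : expR (- u) < 1 by rewrite -[ltRHS]expR0 ltr_expR oppr_lt0.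
  have e0 := expR_gt0 (- u).
  (* Sublinearity is used with eps = 1 - e^(-u), which lies in (0, 1) for every u > 0 and is at most
     u. *)
  have /HC : 0 < 1 - expR (- u) < 1 by rewrite subr_gt0 e1 gtrBl.
  rewrite subKr => /le_trans; apply; rewrite lee_fin ler_pM2l//.
  by have := expR_ge1Dx (- u); lra.
have [C C0 HCe] := real_embedding lam_gt0 lam_incr lam_quasilac (ltW Cmu0) muC.
(* One [C] each for the real and the imaginary part; the 1 makes the constant positive even if [C]
   is 0. *)
exists (2 * C + 1) => [|N c]; first by rewrite ltr_wpDl// mulr_ge0.
pose re := terms lam N (nat_coef (fun i => complex.Re (c i))).
pose im := terms lam N (nat_coef (fun i => complex.Im (c i))).
have leb_le (h : seq (R * R)) :
    (forall x, `|powsum h x| <= Normc.normc (muntz_poly lam c x)) ->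
    (\int[lebesgue_measure]_(x in `[0%R, 1%R]) `|powsum h x|%:E <=
     L1norm01 lebesgue_measure (muntz_poly lam c))%E.
  move=> Hh; apply: ge0_le_integral => //; first exact: measurable_abs_powsum.
    exact: measurable_normc_muntz.
  by move=> x _; rewrite lee_fin.
have L0 : (0 <= L1norm01 lebesgue_measure (muntz_poly lam c))%E.
  apply: integral_ge0 => x _; rewrite lee_fin.
  exact: le_trans (normr_ge0 _) (Re_le_normc _).
apply: (@le_trans _ _ (\int[mu]_(x in `[0%R, 1%R]) (`|powsum re x|%:E + `|powsum im x|%:E))%E).
  apply: ge0_le_integral => //.
  - by move=> x _; rewrite lee_fin; exact: le_trans (normr_ge0 _) (Re_le_normc _).
  - exact: measurable_normc_muntz.
  - by apply: emeasurable_funD; exact: measurable_abs_powsum.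
  - by move=> x _; rewrite -EFinD lee_fin -Re_muntz_poly -Im_muntz_poly normc_le_ReIm.
rewrite ge0_integralD//; [|exact: measurable_abs_powsum|exact: measurable_abs_powsum].
apply: (@le_trans _ _ (C%:E * L1norm01 lebesgue_measure (muntz_poly lam c) +
                       C%:E * L1norm01 lebesgue_measure (muntz_poly lam c))%E).
  apply: leeD; apply: (le_trans (HCe _ _)); apply: lee_wpmul2l; rewrite ?lee_fin//.
    by apply: leb_le => x; rewrite -Re_muntz_poly Re_le_normc.
  by apply: leb_le => x; rewrite -Im_muntz_poly Im_le_normc.
rewrite -ge0_muleDl ?lee_fin//; apply: lee_wpmul2r => //.
by rewrite -EFinD lee_fin; lra.
Qed.
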